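(* With the notation below, $$Z^1_\Gamma=\frac12\sum_{D\in\mathcal D^1}(-2)^{\tilde c(D)}\Big(\prod_{(a,b)\text{ chord of }D}\chi^{a,b}\Big)\prod_{w\text{ free vertex of }D}x_\Gamma^{e_w}.$$
   Context: Graph polynomials. All graphs are finite, may have multiple edges and self-loops, and each edge $e$ has a fixed direction from $\partial_-(e)$ to $\partial_+(e)$. Each edge $e$ carries a variable $\alpha_e$; for $S\subseteq E_G$ put $\alpha_S=\prod_{e\in S}\alpha_e$. $h_1(G)$ is the first Betti number. The Kirchhoff polynomial of a connected graph is $\Psi_G=\sum_T\alpha_{E_G\setminus T}$, summed over spanning trees $T$; for a disconnected graph it is the product over its components. $G/\!\!/S$ denotes contraction of all edges of $S$. A simple cycle $C$ is a connected subgraph in which every vertex has degree $2$; fix one of its two cyclic orientations and set $o_C(e)=+1$ if $e\in C$ is directed along it, $-1$ if against it, and $0$ if $e\notin C$. For $e,f\in E_G$ the cycle polynomial is $\chi_G^{e,f}=\sum_C o_C(e)o_C(f)\Psi_{G/\!\!/C}$, summed over all simple cycles $C$. For words $\mathsf u=u_1\cdots u_k$ and $\mathsf v=v_1\cdots v_k$ whose letters are edges of $G$, with $1\le k\le h_1(G)$, the Dodgson cycle polynomial is $\chi_G^{\mathsf u,\mathsf v}=\Psi_G^{1-k}\sum_{\sigma\in S_k}\operatorname{sgn}(\sigma)\prod_{i=1}^k\chi_G^{u_i,v_{\sigma(i)}}=\Psi_G^{1-k}\det(\chi_G^{u_i,v_j})_{i,j}$. The graph $\Gamma$ and its two vertices.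 Let $\Gamma$ be a connected graph with $N:=h_1(\Gamma)\ge1$, and write $\Psi=\Psi_\Gamma$, $\chi^{e,f}=\chi_\Gamma^{e,f}$, $\chi^{\mathsf u,\mathsf v}=\chi_\Gamma^{\mathsf u,\mathsf v}$. Fix two distinct vertices $x,y$ of $\Gamma$ (the external vertices). Let $\Gamma^\bullet$ be the graph obtained from $\Gamma$ by identifying $x$ and $y$; it has the same edge set and $h_1(\Gamma^\bullet)=N+1$. For a vertex $a$, the spanning forest polynomial $\Phi_\Gamma^{\{x\},\{a,y\}}=\sum\alpha_{E_\Gamma\setminus(T_1\cup T_2)}$ is summed over pairs of vertex-disjoint trees $T_1,T_2$ covering all vertices of $\Gamma$ (a tree may be a single vertex) with $x\in T_1$ and $a,y\in T_2$; it is $0$ if $a=x$. For $e\in E_\Gamma$ set $$x^e_\Gamma=\alpha_e^{-1}\big(\Phi_\Gamma^{\{x\},\{\partial_+(e),y\}}-\Phi_\Gamma^{\{x\},\{\partial_-(e),y\}}\big).$$ Chord diagrams. Let $D_0$ be a chord diagram without chords: a disjoint union of $\ell\ge1$ cycles (base cycles) of lengths $2n_1,\dots,2n_\ell$, with $n_i\ge1$ and $\sum n_i=N$. A base cycle of length $2$ consists of two parallel edges. Its edges (base edges) are coloured $1$ and $2$ alternately along each base cycle, so every vertex meets exactly one base edge of each colour. Its $2N$ vertices are labelled by pairwise distinct edges of $\Gamma$; $e_w$ denotes the label of vertex $w$. (In the paper $\Gamma$ is a QED photon-propagator Feynman graph with external vertices $x,y$, and $D_0$ is its associated chord diagram.)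 Let $E^1$ and $E^2$ be the sets of base edges of colour $1$ and $2$; each is a perfect matching of $V(D_0)$. A chord is an extra edge (colour $0$) joining two distinct vertices. $\mathcal D^1$ is the set of diagrams obtained from $D_0$ by adding $N-1$ pairwise vertex-disjoint chords; exactly two vertices (the free vertices) meet no chord. For $D\in\mathcal D^1$ and $j\in\{1,2\}$, $c_2^j(D)$ is the number of connected components that are cycles in the subgraph formed by all chords and all colour-$j$ base edges (a chord parallel to a colour-$j$ base edge counts as a cycle of length $2$). Set $\tilde c(D)=c_2^1(D)+c_2^2(D)+1$; the $+1$ counts the single tricoloured cycle through the two free vertices. For a chord $(a,b)$ write $\chi^{a,b}:=\chi^{e_a,e_b}$. Words. $\mathsf P_2$ is the set of unordered pairs $\{U,W\}$ of disjoint sets with $U\cup W=V(D_0)$ and $|U|=|W|=N$, such that every colour-$2$ base edge has one endpoint in $U$ and one in $W$. Fix an enumeration $(a_1,b_1),\dots,(a_N,b_N)$ of $E^2$. The representative of $\{U,W\}$ is the pair of words $(\mathsf u_{\rm id},\mathsf v_{\rm id})$ of length $N$ whose $k$-th letters are $e_{a_k}$ and $e_{b_k}$: the letter whose vertex lies in $U$ goes into $\mathsf u_{\rm id}$ and the other into $\mathsf v_{\rm id}$. Partitions. Let $\mathcal E=\{E_1,\dots,E_m\}$ be a partition of $E^1$ into $m=|\mathcal E|$ nonempty parts, listed in any order, and let $V_i$ be the set of endpoints of edges of $E_i$. For $\{U,W\}\in\mathsf P_2$, let $\mathsf u_i$ (resp. $\mathsf v_i$) be the subword of $\mathsf u_{\rm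 id}$ (resp. $\mathsf v_{\rm id}$) consisting of the letters $e_w$ with $w\in V_i$, in their original order. - If $|\mathsf u_i|=|\mathsf v_i|$ for all $i$, set $\operatorname{sgn}_{\mathcal E}=\operatorname{sgn}(\sigma)\operatorname{sgn}(\sigma')$, where $\sigma,\sigma'\in S_N$ are the permutations of letter positions with $\mathsf u_1\cdots\mathsf u_m=\sigma(\mathsf u_{\rm id})$ and $\mathsf v_1\cdots\mathsf v_m=\sigma'(\mathsf v_{\rm id})$. - Otherwise set $\operatorname{sgn}_{\mathcal E}=0$, and the corresponding summand is $0$. First order partition polynomial. For $1\le l\le N$, $$Z^1|_l=\sum_{\mathcal E:\,|\mathcal E|=l}\ \sum_{\{U,W\}\in\mathsf P_2}\operatorname{sgn}_{\mathcal E}\sum_{j=1}^l\Big(\chi_{\Gamma^\bullet}^{\mathsf u_j,\mathsf v_j}-\frac{\Psi_{\Gamma^\bullet}}{\Psi}\chi^{\mathsf u_j,\mathsf v_j}\Big)\prod_{i\ne j}\chi^{\mathsf u_i,\mathsf v_i},$$ where $\mathcal E$ runs over partitions of $E^1$, and $$Z^1_\Gamma=\frac12\sum_{l=1}^N(-\Psi)^{N-l+1}(l+1)!\,Z^1|_l.$$ *)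

(* Defs.v *)
From HB Require Import structures.
From mathcomp Require Import all_boot all_order all_algebra all_fingroup.
Set Implicit Arguments.
Unset Strict Implicit.
Unset Printing Implicit Defensive.
Import Order.TTheory GRing.Theory Num.Theory.
Local Open Scope ring_scope.

Record graph (V E : finType) := Graph {
  gvs : {set V};
  ges : {set E};
  gsrc : E -> V;
  gtgt : E -> V }.

Section Graphs.
Variables (V E : finType).
Implicit Types (G : graph V E) (S T F C s : {set E}).

Definition adj G T : rel V := fun u v =>
  [exists e in T, ((gsrc G e == u) && (gtgt G e == v))
               || ((gsrc G e == v) && (gtgt G e == u))].

Definition spanning_tree G T : bool :=
  [&& T \subset ges G,
      [forall u in gvs G, forall v in gvs G, connect (adj G T) u v]
    & #|T|.+1 == #|gvs G| ].

Definition Kirchhoff (R : comNzRingType) G (alpha : E -> R) : R :=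
  \sum_(T : {set E} | spanning_tree G T) \prod_(e in ges G :\: T) alpha e.

Definition contract G S : graph V E :=
  let r := fingraph.root (adj G S) in
  Graph [set v in gvs G | r v == v] (ges G :\: S) (r \o gsrc G) (r \o gtgt G).

Definition identify G (x y : V) : graph V E :=
  let f := fun v => if v == y then x else v in
  Graph (gvs G :\ y) (ges G) (f \o gsrc G) (f \o gtgt G).

(* degree of v in the subgraph formed by C (a self-loop counts twice) *)
Definition sdeg G C (v : V) : nat :=
  #|[set e in C | gsrc G e == v]| + #|[set e in C | gtgt G e == v]|.

Definition simple_cycle G C : bool :=
  [&& C \subset ges G, C != set0,
      [forall e in C, forall f in C, connect (adj G C) (gsrc G e) (gsrc G f)]
    & [forall v, (sdeg G C v == 0%N) || (sdeg G C v == 2%N)] ].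

(* a cyclic orientation of C: s = edges of C directed along it, C :\: s the
   edges directed against it; at every vertex one enters and one leaves
   (in-degree = out-degree along the orientation) *)
Definition cyc_orient G C s : bool :=
  (s \subset C) &&
  [forall v, #|[set e in s | gtgt G e == v]| + #|[set e in C :\: s | gsrc G e == v]|
          == #|[set e in s | gsrc G e == v]| + #|[set e in C :\: s | gtgt G e == v]|].

Definition ocyc (R : nzRingType) C s (e : E) : R :=
  if e \in s then 1 else if e \in C then -1 else 0.

Definition cyclepoly (R : comNzRingType) G (alpha : E -> R) (e f : E) : R :=
  \sum_(C : {set E} | simple_cycle G C)
    let s := odflt set0 [pick s | cyc_orient G C s] in
    ocyc R C s e * ocyc R C s f * Kirchhoff (contract G C) alpha.

Definition dodgson (R : fieldType) G (alpha : E -> R) (u v : seq E) : R :=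
  match u with
  | [::] => Kirchhoff G alpha
  | e0 :: _ =>
    let k := size u in
    (Kirchhoff G alpha) ^- k.-1 *
      \det (\matrix_(i < k, j < k) cyclepoly G alpha (nth e0 u i) (nth e0 v j))
  end.

(* spanning forest polynomial Phi_G^{{x},{a,y}}: sum over spanning forests F
   with exactly two trees, one containing x, the other containing a and y *)
Definition Phi2 (R : comNzRingType) G (alpha : E -> R) (x a y : V) : R :=
  \sum_(F : {set E} | [&& F \subset ges G, #|F|.+2 == #|gvs G|,
          [forall v in gvs G, connect (adj G F) x v || connect (adj G F) y v],
          ~~ connect (adj G F) x y & connect (adj G F) a y])
    \prod_(e in ges G :\: F) alpha e.

Definition xedge (R : fieldType) G (alpha : E -> R) (x y : V) (e : E) : R :=
  (alpha e)^-1 * (Phi2 G alpha x (gtgt G e) y - Phi2 G alpha x (gsrc G e) y).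

End Graphs.

(* Chord diagrams.  Vertices of D_0 : 'I_(n.*2) (n = N).  The colour-1 *)
(* and colour-2 base edges are perfect matchings given by their        *)
(* partner maps M1, M2 (fixed-point-free involutions).                 *)
Section Chords.
Variable n : nat.
Local Notation W := 'I_(n.*2).

(* D in D^1 <-> chord partner map c: involution, chords join distinct
   vertices, exactly two fixed points (the free vertices) *)
Definition isD1 (c : {ffun W -> W}) : bool :=
  [forall w, c (c w) == w] && (#|[set w | c w == w]| == 2%N).

Definition chordrel (Mj : W -> W) (c : {ffun W -> W}) : rel W :=
  fun w z => (z == Mj w) || ((z == c w) && (c w != w)).

(* c_2^j(D): number of components (represented by their roots) that are
   cycles, i.e. all of whose vertices have degree 2 (= meet a chord) *)
Definition c2 (Mj : W -> W) (c : {ffun W -> W}) : nat :=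
  #|[set w : W | (fingraph.root (chordrel Mj c) w == w)
        && [forall z, connect (chordrel Mj c) w z ==> (c z != z)]]|.

Variables (M1 M2 : W -> W) (a : 'I_n -> W).
(* enumeration (a_k, b_k) of E^2 : a_k = a k, b_k = M2 (a k) *)

Definition isP2 (P : {set {set W}}) : bool :=
  [exists U : {set W}, [&& P == [set U; ~: U], #|U| == n
                          & [forall w, (w \in U) != (M2 w \in U)]]].

Definition repU (P : {set {set W}}) : {set W} := odflt set0 [pick U in P].

(* vertex giving the k-th letter of u_id, resp. v_id *)
Definition uvert (U : {set W}) (k : 'I_n) : W :=
  if a k \in U then a k else M2 (a k).
Definition vvert (U : {set W}) (k : 'I_n) : W :=
  if a k \in U then M2 (a k) else a k.

(* admissible partitions of E^1: partitions of the vertex set into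
   nonempty blocks V_i each closed under M1 (block V_i = endpoints of E_i) *)
Definition isPart (Pt : {set {set W}}) : bool :=
  partition Pt [set: W] && [forall B in Pt, forall w in B, M1 w \in B].

Definition bidx (Pt : {set {set W}}) (w : W) : nat := index (pblock Pt w) (enum Pt).

(* new position of the letter at position k in u_1 ... u_m *)
Definition newpos (Pt : {set {set W}}) (f : 'I_n -> W) (k : 'I_n) : nat :=
  #|[set k' : 'I_n | (bidx Pt (f k') < bidx Pt (f k))%N
                     || ((bidx Pt (f k') == bidx Pt (f k)) && (k' < k)%N)]|.

(* sign of the permutation of positions realising the reordering *)
Definition psign (R : nzRingType) (Pt : {set {set W}}) (f : 'I_n -> W) : R :=
  \sum_(s : 'S_n | [forall k, (s k : nat) == newpos Pt f k]) (-1) ^+ s.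

Definition sgnE (R : nzRingType) (Pt : {set {set W}}) (U : {set W}) : R :=
  if [forall B in Pt, #|[set k | uvert U k \in B]| == #|[set k | vvert U k \in B]|]
  then psign R Pt (uvert U) * psign R Pt (vvert U) else 0.

End Chords.

Section Z1.
Variables (R : fieldType) (V E : finType) (Gam Gbul : graph V E) (alpha : E -> R).
Variables (n : nat) (M1 M2 : 'I_(n.*2) -> 'I_(n.*2)) (a : 'I_n -> 'I_(n.*2))
          (lab : 'I_(n.*2) -> E).

Definition uword (U B : {set 'I_(n.*2)}) : seq E :=
  [seq lab (uvert M2 a U k) | k <- enum 'I_n & uvert M2 a U k \in B].
Definition vword (U B : {set 'I_(n.*2)}) : seq E :=
  [seq lab (vvert M2 a U k) | k <- enum 'I_n & vvert M2 a U k \in B].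

Definition Z1l (l : nat) : R :=
  \sum_(Pt : {set {set 'I_(n.*2)}} | isPart M1 Pt && (#|Pt| == l))
   \sum_(P : {set {set 'I_(n.*2)}} | isP2 M2 P)
     let U := repU P in
     sgnE M2 a R Pt U *
     \sum_(B in Pt)
       (dodgson Gbul alpha (uword U B) (vword U B)
        - Kirchhoff Gbul alpha / Kirchhoff Gam alpha
          * dodgson Gam alpha (uword U B) (vword U B))
       * \prod_(B' in Pt | B' != B) dodgson Gam alpha (uword U B') (vword U B').

Definition Z1 : R :=
  2^-1 * \sum_(1 <= l < n.+1)
     (- Kirchhoff Gam alpha) ^+ (n - l + 1) * ((l + 1)`!)%:R * Z1l l.

Definition Z1chords (x y : V) : R :=
  2^-1 * \sum_(c : {ffun 'I_(n.*2) -> 'I_(n.*2)} | isD1 c)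
    (-2) ^+ (c2 M1 c + c2 M2 c + 1)
    * (\prod_(w : 'I_(n.*2) | (w < c w)%N) cyclepoly Gam alpha (lab w) (lab (c w)))
    * (\prod_(w : 'I_(n.*2) | c w == w) xedge Gam alpha x y (lab w)).

End Z1.

(* Main.v *)
(** The identity splits into a statement about graphs and one about matchings.

    Graphs: the edge weights alpha define a bilinear form <z, z'> = sum_e alpha_e z_e z'_e on edge
    functions. The function chi^{.,f} is the circulation representing z |-> Psi z_f on the
    circulations of Gamma, because pairs (cycle, spanning tree of the contraction) correspond to
    pairs (spanning tree T, edge outside T), and a circulation is the combination of the fundamental
    cycles of T with its values outside T as coefficients. Up to the factor Psi, x^. is the unit
    electrical flow between x and y: it is orthogonal to the circulations of Gamma and completes
    them to the circulations of Gamma^bullet. As the form determines circulations, this gives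
    Psi chi_bullet^{e,f} = Psi_bullet chi^{e,f} + x^e x^f.

    Matchings: by this rank one relation, chi^{u,v} / Psi and the bracket of the first order
    polynomial are the coefficients of t^0 and t^1 of det (chi / Psi + t x x^T / Psi). Expanding the
    product of these determinants over the parts of a partition, Z^1 becomes a sum over perfect
    matchings m of V(D_0), whose t^1 coefficient marks one chord of m, i.e. opens it into a diagram
    D of D^1. A matching m forming C_1 and C_2 cycles with E^1 and E^2 gets the sign
    (-1)^(N - C_2) for each of the 2^(C_2 - 1) compatible pairs {U, W}, and the sum
    (-2)^(C_1) of (-1)^l (l+1)! over the compatible partitions; here C_j = c_2^j(D) + 1. *)

Require Import Defs.
From HB Require Import structures.
From mathcomp Require Import all_boot all_order all_algebra all_fingroup.
From mathcomp Require Import ring.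
Set Implicit Arguments.
Unset Strict Implicit.
Unset Printing Implicit Defensive.
Import Order.TTheory GRing.Theory Num.Theory.
Local Open Scope ring_scope.

(** * Flows, spanning trees and cycles *)

(** Fewer equations than unknowns leave a kernel. It serves twice: with unknowns on edges it
    produces circulations, with unknowns on vertices it produces potentials. *)
Lemma nontrivial_solution (R : fieldType) (I J : finType) (S : {set I})
    (W : {set J}) (A : I -> J -> R) : (#|W| < #|S|)%N ->
  exists z : I -> R, [/\ forall i, i \notin S -> z i = 0, exists i, z i != 0
    & forall j, j \in W -> \sum_i z i * A i j = 0].
Proof.
move=> ltWS.
pose M := \matrix_(i < #|S|, j < #|W|) A (enum_val i) (enum_val j).
have : kermx M != 0.
  by rewrite -mxrank_eq0 mxrank_ker -lt0n subn_gt0 (leq_ltn_trans (rank_leq_col M)).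
case/rowV0Pn=> v /sub_kermxP vM v0.
pose z i := \sum_(k < #|S| | enum_val k == i) v 0 k.
have zE k : z (enum_val k) = v 0 k.
  rewrite /z (big_pred1 k) // => k'; exact: (inj_eq enum_val_inj).
exists z; split.
- move=> i iS; rewrite /z big1 // => k /eqP ki.
  by rewrite -ki enum_valP in iS.
- have /rV0Pn [k vk] := v0.
  by exists (enum_val k); rewrite zE.
- move=> j jW; pose j' := enum_rank_in jW j.
  have := congr1 (fun N : 'rV_ _ => N 0 j') vM; rewrite !mxE => vM0; rewrite -[RHS]vM0.
  transitivity (\sum_i \sum_(k < #|S| | enum_val k == i) v 0 k * A i j).
    by apply: eq_bigr => i _; rewrite mulr_suml.
  rewrite (exchange_big_dep xpredT) //=; apply: eq_bigr => k _.
  by rewrite (big_pred1 (enum_val k)) ?mxE ?enum_rankK_in.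
Qed.

(** * Connectivity tested by functions that are constant along edges *)

Section Connectivity.
Variables (V E : finType) (G : graph V E).
Implicit Types (S T C : {set E}) (u v w : V) (e : E).

Lemma adj_sym S : symmetric (adj G S).
Proof.
by move=> u v; apply/existsP/existsP => -[e /andP [eS /orP h]];
  exists e; rewrite eS; case: h => ->; rewrite ?orbT.
Qed.

Lemma connect_adjC S : connect_sym (adj G S).
Proof. exact/sym_connect_sym/adj_sym. Qed.

Lemma connect_edge S e : e \in S -> connect (adj G S) (gsrc G e) (gtgt G e).
Proof. by move=> eS; apply: connect1; apply/existsP; exists e; rewrite eS !eqxx. Qed.

Lemma connect_const (X : Type) (phi : V -> X) S u v :
    (forall e, e \in S -> phi (gsrc G e) = phi (gtgt G e)) ->
  connect (adj G S) u v -> phi u = phi v.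
Proof.
move=> phiS /connectP [p pth ->]; elim: p u pth => //= w p IHp u /andP [].
case/existsP=> e /andP [eS ends] /IHp <-.
by case/orP: ends => /andP [/eqP <- /eqP <-]; rewrite phiS.
Qed.

Lemma connect_edge_eq S e u : e \in S ->
  connect (adj G S) u (gsrc G e) = connect (adj G S) u (gtgt G e).
Proof.
move=> eS; have C := connect_edge eS.
by apply/idP/idP => /connect_trans; apply; rewrite // connect_adjC.
Qed.

(** Converse of [connect_const]: the test function is the component of [u]. Connectivity proofs can
    thus follow Boolean potentials instead of paths. *)
Lemma connect_pot S u v :
    (forall phi : V -> bool, (forall e, e \in S -> phi (gsrc G e) = phi (gtgt G e)) ->
      phi u = phi v) ->
  connect (adj G S) u v.
Proof. by move=> /(_ (connect (adj G S) u)) <- // e; apply: connect_edge_eq. Qed.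

Lemma connect_del S e u v :
    connect (adj G (S :\ e)) (gsrc G e) (gtgt G e) ->
  connect (adj G S) u v -> connect (adj G (S :\ e)) u v.
Proof.
move=> Ce Cuv; apply: connect_pot => phi phiS.
apply: connect_const Cuv => e' e'S; have [-> | ne] := eqVneq e' e.
  exact: connect_const phiS Ce.
by apply: phiS; rewrite !inE ne.
Qed.

End Connectivity.

(** * Divergence of edge flows, and spanning trees *)

Section Flows.
Variables (R : fieldType) (V E : finType) (G : graph V E).
Implicit Types (S T C : {set E}) (u v w : V) (e : E) (z : E -> R).

Local Notation src := (gsrc G).
Local Notation tgt := (gtgt G).

(** The signed incidence matrix; the two terms cancel at a self-loop. *)
Definition inc e v : R := (tgt e == v)%:R - (src e == v)%:R.
Definition div z v := \sum_e z e * inc e v.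
Definition circulation z := forall v, div z v = 0.
Definition supported S z := forall e, e \notin S -> z e = 0.

Lemma sum_inc (phi : V -> R) e : \sum_v phi v * inc e v = phi (tgt e) - phi (src e).
Proof.
rewrite (eq_bigr (fun v => phi v * (tgt e == v)%:R - phi v * (src e == v)%:R)); last first.
  by move=> v _; rewrite mulrBr.
have S1 w : \sum_v phi v * (w == v)%:R = phi w.
  rewrite (bigD1 w) //= eqxx mulr1 big1 ?addr0 // => v.
  by rewrite eq_sym => /negbTE ->; rewrite mulr0.
by rewrite sumrB !S1.
Qed.

(** Summation by parts: the divergence is adjoint to taking potential differences. *)
Lemma green (phi : V -> R) z :
  \sum_v phi v * div z v = \sum_e z e * (phi (tgt e) - phi (src e)).
Proof.
transitivity (\sum_v \sum_e z e * (phi v * inc e v)).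
  by apply: eq_bigr => v _; rewrite mulr_sumr; apply: eq_bigr => e _; rewrite mulrCA.
rewrite exchange_big; apply: eq_bigr => e _.
by rewrite -mulr_sumr sum_inc.
Qed.

Lemma sum_div z : \sum_v div z v = 0.
Proof.
have := green (fun=> 1) z; rewrite (eq_bigr (div z)); last by move=> v _; rewrite mul1r.
by move=> ->; rewrite big1 // => e _; rewrite subrr mulr0.
Qed.

Lemma div_lin c d z1 z2 v : div (fun e => c * z1 e + d * z2 e) v = c * div z1 v + d * div z2 v.
Proof.
rewrite /div !mulr_sumr -big_split; apply: eq_bigr => e _ /=.
by rewrite mulrDl !mulrA.
Qed.

Lemma eq_div z1 z2 : z1 =1 z2 -> div z1 =1 div z2.
Proof. by move=> eqz v; apply: eq_bigr => e _; rewrite eqz. Qed.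

(** Unit flow along a path, with -1 on edges traversed backwards; contributions of a repeated edge
    add up. *)
Lemma connect_flow S u v : connect (adj G S) u v ->
  exists p, supported S p /\ forall w, div p w = (v == w)%:R - (u == w)%:R.
Proof.
case/connectP=> p pth ->; elim: p u pth => [|w p IHp] u /=.
  move=> _; exists (fun=> 0); split=> // w; rewrite subrr /div big1 // => e _.
  by rewrite mul0r.
case/andP=> /existsP [e /andP [eS ends]] /IHp [q [qS dq]].
have de c w' : div (fun e' => (e' == e)%:R * c + 1 * q e') w' = c * inc e w' + div q w'.
  rewrite /div (eq_bigr (fun e' => (e' == e)%:R * (c * inc e' w') + q e' * inc e' w')).
    rewrite big_split /= (bigD1 e) //= eqxx mul1r big1 ?addr0 //.
    by move=> e' /negbTE ->; rewrite mul0r.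
  by move=> e' _; rewrite mulrDl mul1r mulrA.
have suppc c : supported S (fun e' => (e' == e)%:R * c + 1 * q e').
  move=> e' e'S; rewrite qS // mulr0 addr0.
  by case: eqP e'S => [-> | _]; rewrite ?eS // mul0r.
case/orP: ends => /andP [/eqP su /eqP tw].
  exists (fun e' => (e' == e)%:R * 1 + 1 * q e'); split=> // w'.
  by rewrite de dq /inc su tw mul1r addrC addrA subrK.
exists (fun e' => (e' == e)%:R * (-1) + 1 * q e'); split=> // w'.
by rewrite de dq /inc su tw mulN1r opprB addrC addrA subrK.
Qed.

(** [green] applied to the indicator of a cut that no edge of [S] other than [e] can cross: all net
    flow across the cut passes through [e]. *)
Lemma cut_flow S e z u v (phi : V -> bool) : supported S z ->
    (forall w, div z w = (v == w)%:R - (u == w)%:R) ->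
    (forall e', e' \in S :\ e -> phi (src e') = phi (tgt e')) ->
  z e * ((phi (tgt e))%:R - (phi (src e))%:R) = (phi v)%:R - (phi u)%:R.
Proof.
move=> zS dz phiS; have := green (fun w => (phi w)%:R) z.
rewrite [RHS](bigD1 e) //= [X in _ = _ + X]big1 ?addr0.
  move=> <-; have S1 a : \sum_w (phi w)%:R * (a == w)%:R = (phi a)%:R :> R.
    rewrite (bigD1 a) //= eqxx mulr1 big1 ?addr0 // => w.
    by rewrite eq_sym => /negbTE ->; rewrite mulr0.
  rewrite (eq_bigr (fun w => (phi w)%:R * (v == w)%:R - (phi w)%:R * (u == w)%:R)).
    by rewrite sumrB !S1.
  by move=> w _; rewrite dz mulrBr.
move=> e' ne; have [e'S | e'S] := boolP (e' \in S); last by rewrite zS // mul0r.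
by rewrite phiS ?subrr ?mulr0 // !inE ne.
Qed.

(** If deleting [e] separated its ends, [e] alone would cross a cut, and a circulation has no net
    flow across a cut. *)
Lemma circulation_connect S e z : supported S z -> circulation z -> z e != 0 ->
  connect (adj G (S :\ e)) (src e) (tgt e).
Proof.
move=> zS cz ze; set phi := connect (adj G (S :\ e)) (src e).
have := @cut_flow S e z (src e) (src e) phi zS.
rewrite subrr => /(_ _ _)/eqP; rewrite mulf_eq0 (negbTE ze) /= subr_eq0.
have -> : phi (src e) by apply: connect0.
case: (phi (tgt e)) => // H; rewrite eq_sym oner_eq0 in H; apply: H.
  by move=> w; rewrite cz subrr.
by move=> e' e'S; apply: connect_edge_eq.
Qed.

(** With fewer edges, counting equations gives a nonzero potential that vanishes at [w0] and is
    constant along [S]; connectivity forces it to vanish on all of [W]. *)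
Lemma card_connected S (W : {set V}) :
    (forall u v, u \in W -> v \in W -> connect (adj G S) u v) ->
  (#|W| <= #|S|.+1)%N.
Proof.
move=> CW; have [-> | [w0 w0W]] := set_0Vmem W; first by rewrite cards0.
rewrite leqNgt (cardsD1 w0) w0W ltnS; apply/negP => lt.
have [phi [phi0 [w phiw] phiS]] := nontrivial_solution (fun v e => inc e v) lt.
have wW : w \in W.
  by apply: contraR phiw => wW; rewrite phi0 // !inE (negbTE wW) andbF.
have : phi w0 = 0 by apply: phi0; rewrite !inE eqxx.
rewrite -(connect_const (phi := phi) _ (CW _ _ wW w0W)); first exact/eqP.
by move=> e /phiS; rewrite sum_inc => /eqP; rewrite subr_eq0 => /eqP.
Qed.

Lemma spanning_treeP T : reflect [/\ T \subset ges G,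
    forall u v, u \in gvs G -> v \in gvs G -> connect (adj G T) u v
  & #|T|.+1 = #|gvs G|] (spanning_tree G T).
Proof.
apply: (iffP and3P) => [[sT cT /eqP nT] | [sT cT nT]]; split=> //; last exact/eqP.
  move=> u v ug vg; move/forallP: cT => /(_ u) /implyP /(_ ug) /forallP /(_ v).
  by move/implyP; apply.
by apply/forallP => u; apply/implyP => ug; apply/forallP => v; apply/implyP; apply: cT.
Qed.

(** An edge with nonzero flow could be deleted without disconnecting the graph, which would leave
    too few edges. *)
Lemma tree_circulation T z :
  spanning_tree G T -> supported T z -> circulation z -> z =1 fun=> 0.
Proof.
case/spanning_treeP=> sT cT nT zT cz e; apply/eqP; apply: wlog_neg => ze.
have eT : e \in T by apply: contraR ze => /zT ->.
suff : (#|gvs G| <= #|T :\ e|.+1)%N by rewrite -nT (cardsD1 e T) eT ltnn.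
apply: card_connected => u v ug vg.
exact: connect_del (circulation_connect zT cz ze) (cT u v ug vg).
Qed.

(** Divergences sum to zero, so the equation at one vertex [w0] is redundant and [#|W| <= #|S|]
    already leaves more unknowns than equations. *)
Lemma dependent_circulation S (W : {set V}) :
    (forall e, e \in S -> src e \in W /\ tgt e \in W) -> (0 < #|W| <= #|S|)%N ->
  exists z, [/\ supported S z, exists e, z e != 0 & circulation z].
Proof.
move=> SW /andP [W0 leWS]; have /card_gt0P [w0 w0W] := W0.
have lt : (#|W :\ w0| < #|S|)%N by rewrite (cardsD1 w0 W) w0W in leWS.
have [z [zS z0 zW]] := nontrivial_solution inc lt.
exists z; split=> //.
have dz v : v != w0 -> div z v = 0.
  move=> vw0; have [vW | vW] := boolP (v \in W); first by apply: zW; rewrite !inE vw0.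
  rewrite /div big1 // => e _; have [/SW [sW tW] | eS] := boolP (e \in S); last first.
    by rewrite zS // mul0r.
  rewrite /inc; case: eqP tW => [-> | _ _]; first by rewrite (negbTE vW).
  by case: eqP sW => [-> | _ _]; [rewrite (negbTE vW) | rewrite subrr mulr0].
move=> v; have [-> | /dz //] := eqVneq v w0.
have := sum_div z; rewrite (bigD1 w0) //= big1 ?addr0 // => v'; exact: dz.
Qed.

End Flows.

(** * Simple cycles and their cyclic orientations *)

Section Cycles.
Variables (R : fieldType) (V E : finType) (G : graph V E).
Hypothesis char0 : [pchar R] =i pred0.
Hypothesis wfG : forall e, e \in ges G -> gsrc G e \in gvs G /\ gtgt G e \in gvs G.
Implicit Types (S T C s : {set E}) (u v w : V) (e : E) (z : E -> R).

Local Notation src := (gsrc G).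
Local Notation tgt := (gtgt G).
Local Notation inc := (inc R G).
Local Notation div := (div G).
Local Notation circulation := (circulation G).

Definition cycle_vertices C := [set v | sdeg G C v != 0%N].

Lemma mem_cycle_vertices C e : e \in C ->
  src e \in cycle_vertices C /\ tgt e \in cycle_vertices C.
Proof.
move=> eC; rewrite !inE /sdeg !addn_eq0 !negb_and -!lt0n; split; apply/orP.
  by left; apply/card_gt0P; exists e; rewrite inE eC eqxx.
by right; apply/card_gt0P; exists e; rewrite inE eC eqxx.
Qed.

Lemma sum_sdeg C : (\sum_v sdeg G C v = #|C|.*2)%N.
Proof.
have sumf (f : E -> V) : (\sum_v #|[set e in C | f e == v]| = #|C|)%N.
  rewrite -sum1_card (partition_big f xpredT) //=; apply: eq_bigr => v _.
  by rewrite -sum1_card; apply: eq_bigl => e; rewrite inE.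
by rewrite big_split /= !sumf addnn.
Qed.

Lemma div_supported C z v : supported C z ->
  div z v = \sum_(e in [set e in C | tgt e == v]) z e
            - \sum_(e in [set e in C | src e == v]) z e.
Proof.
move=> zC; have sumf (f : E -> V) :
    \sum_(e in [set e in C | f e == v]) z e = \sum_e z e * (f e == v)%:R.
  rewrite big_mkcond; apply: eq_bigr => e _; rewrite inE.
  have [eC | /zC ->] := boolP (e \in C); last by rewrite mul0r.
  by case: (f e == v); rewrite ?mulr1 ?mulr0.
by rewrite !sumf -sumrB; apply: eq_bigr => e _; rewrite mulrBr.
Qed.

(** A vertex of degree one would have the nonzero value on its only edge as divergence, up to
    sign. *)
Lemma sdeg_support C z v : supported C z -> (forall e, e \in C -> z e != 0) ->
  circulation z -> sdeg G C v != 1%N.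
Proof.
move=> zC Cz /(_ v); rewrite (div_supported _ zC) /sdeg => dv; apply/eqP.
have single (A B : {set E}) : #|A| = 1%N -> #|B| = 0%N -> A \subset C ->
    \sum_(e in A) z e - \sum_(e in B) z e != 0.
  move=> /eqP /cards1P [e ->] /eqP; rewrite cards_eq0 => /eqP -> /subsetP sC.
  by rewrite big_set1 big_set0 subr0 Cz // sC // set11.
have sub (f : E -> V) : [set e in C | f e == v] \subset C.
  by apply/subsetP => e; rewrite inE => /andP [].
case src1: #|[set e in C | src e == v]| => [|[|k]] //=.
- by rewrite add0n => /single /(_ src1 (sub _)); rewrite dv eqxx.
- rewrite add1n => -[] tgt0; have := single _ _ src1 tgt0 (sub _).
  by rewrite -oppr_eq0 opprB dv eqxx.
Qed.

(** [e |: T] has as many edges as [G] has vertices, so it carries a nonzero circulation; a tree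
    carries none, so the value at [e] is nonzero and can be normalised. *)
Lemma tree_fundamental T e : spanning_tree G T -> e \in ges G -> e \notin T ->
  exists z, [/\ supported (e |: T) z, circulation z & z e = 1].
Proof.
move=> tT eg eT; have [sT cT nT] := spanning_treeP _ _ tT.
have [] := @dependent_circulation R V E G (e |: T) (gvs G).
- move=> e' /setU1P [-> | e'T]; first exact: wfG.
  by apply: wfG; apply: (subsetP sT).
- by rewrite -nT cardsU1 eT /=.
move=> z [zT [e' ze'] cz]; have ze : z e != 0.
  apply: contra_neq ze' => ze; apply: (tree_circulation tT _ cz) => e1 e1T.
  have [-> // | ne] := eqVneq e1 e.
  by apply: zT; rewrite !inE negb_or ne.
(* The zero term gives the scalar multiple the two-term shape of [div_lin]. *)
exists (fun e' => (z e)^-1 * z e' + 0 * z e'); split.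
- by move=> e1 /zT ->; rewrite !mulr0 addr0.
- by move=> v; rewrite div_lin cz !mulr0 addr0.
- by rewrite mulVf // mul0r addr0.
Qed.

(** All degrees on the support are at least 2. If there are at most as many edges as vertices, the
    degree sum forces each of them to be exactly 2. *)
Lemma support_simple_cycle T e z : spanning_tree G T -> e \in ges G -> e \notin T ->
    supported (e |: T) z -> circulation z -> z e != 0 ->
  simple_cycle G [set e' | z e' != 0].
Proof.
move=> tT eg eT zT cz ze; have [sT cT nT] := spanning_treeP _ _ tT.
set C := [set _ | _]; have zC : supported C z by move=> e'; rewrite inE negbK => /eqP.
have Cz e' : e' \in C -> z e' != 0 by rewrite inE.
have eC : e \in C by rewrite inE.
have CT e' : e' \in C -> e' = e \/ e' \in T.
  move=> e'C; have [->|ne] := eqVneq e' e; first by left.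
  by right; apply: contraR (Cz _ e'C) => e'T; rewrite zT // !inE negb_or ne.
have deg2 v : v \in cycle_vertices C -> (2 <= sdeg G C v)%N.
  by rewrite inE; case: (sdeg G C v) (sdeg_support v zC Cz cz) => [|[|k]].
(* Otherwise the support without [e] carries a nonzero circulation, which lives on the tree. *)
have leC : (#|C| <= #|cycle_vertices C|)%N.
  rewrite leqNgt; apply/negP; rewrite (cardsD1 e C) eC ltnS => lt.
  have [||y [yC [e' ye'] cy]] := @dependent_circulation R V E G (C :\ e) (cycle_vertices C).
  - by move=> e' /setD1P [_]; apply: mem_cycle_vertices.
  - rewrite lt andbT; apply/card_gt0P; exists (src e).
    by case: (mem_cycle_vertices eC).
  case/eqP: ye'; apply: (tree_circulation tT _ cy) => e1 e1T; apply: yC.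
  apply: contra e1T => /setD1P [ne /CT [eq | //]].
  by rewrite eq eqxx in ne.
have degE : [forall (v | v \in cycle_vertices C), 2 == sdeg G C v].
  have H : forall v, v \in cycle_vertices C -> (2 <= sdeg G C v ?= iff (2 == sdeg G C v))%N.
    by move=> v vC; split=> //; apply: deg2.
  have [_ <-] := leqif_sum H.
  have : (\sum_(v in cycle_vertices C) sdeg G C v = #|C|.*2)%N.
    rewrite -sum_sdeg [RHS](bigID [in cycle_vertices C]) /= [X in (_ + X)%N]big1 ?addn0 //.
    by move=> v; rewrite inE negbK => /eqP.
  move=> sC; rewrite eqn_leq leq_sum //= sC sum_nat_const muln2 leq_double //.
have cC f : f \in C -> connect (adj G C) (src e) (src f).
  (* The part of [z] on the component of [e] is again a circulation and agrees with [z] at [e], so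
     their difference lives on the tree and vanishes. *)
  pose z' e1 := (connect (adj G C) (src e) (src e1))%:R * z e1.
  have cz' : circulation z'.
    move=> v; rewrite -[RHS](mulr0 (connect (adj G C) (src e) v)%:R) -(cz v).
    rewrite /div mulr_sumr; apply: eq_bigr => e2 _; rewrite /z' -mulrA.
    have [e2C | /zC ->] := boolP (e2 \in C); last by rewrite !mul0r !mulr0.
    rewrite /inc; have [<-|nt] := eqVneq (tgt e2) v.
      by rewrite (connect_edge_eq _ _ e2C).
    by have [-> // | ns] := eqVneq (src e2) v; rewrite subrr !mulr0.
  pose d e1 := 1 * z e1 + (-1) * z' e1.
  have /(tree_circulation tT) d0 : supported T d.
    move=> e1 e1T; rewrite /d mul1r mulN1r; have [->|ne] := eqVneq e1 e.
      by rewrite /z' connect0 mul1r subrr.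
    by rewrite /z' zT ?mulr0 ?subrr // !inE negb_or ne.
  have /d0 dE : circulation d by move=> v; rewrite div_lin cz cz' !mulr0 addr0.
  move=> e1C; have := dE f; rewrite /d mul1r mulN1r /z'.
  case: connect => //; rewrite mul0r subr0 => ze1.
  by have := Cz _ e1C; rewrite ze1 eqxx.
apply/and4P; split.
- apply/subsetP => e' /CT [-> // | ]; exact: (subsetP sT).
- by apply/set0Pn; exists e.
- apply/forallP => e1; apply/implyP => e1C; apply/forallP => e2; apply/implyP => e2C.
  by apply: connect_trans (cC _ e2C); rewrite connect_adjC cC.
- apply/forallP => v; have [// | vC] := eqVneq (sdeg G C v) 0%N.
  by move/forallP: degE => /(_ v) /implyP; rewrite inE vC eq_sym; apply.
Qed.

Lemma simple_cycleP C : simple_cycle G C ->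
  [/\ C \subset ges G, C != set0,
      forall e f, e \in C -> f \in C -> connect (adj G C) (src e) (src f)
    & forall v, v \in cycle_vertices C -> sdeg G C v = 2%N].
Proof.
case/and4P=> sC C0 cC /forallP dC; split=> //.
  move=> e f eC fC; move/forallP: cC => /(_ e) /implyP /(_ eC) /forallP /(_ f).
  by move/implyP; apply.
by move=> v; rewrite inE => v0; have := dC v; rewrite (negbTE v0) => /eqP.
Qed.

Lemma card_cycle_vertices C : simple_cycle G C -> #|cycle_vertices C| = #|C|.
Proof.
case/simple_cycleP=> _ _ _ d2; apply: double_inj.
rewrite -sum_sdeg (bigID [in cycle_vertices C]) /= [X in (_ + X)%N]big1 ?addn0.
  by rewrite (eq_bigr (fun=> 2)) ?sum_nat_const ?muln2.
by move=> v; rewrite inE negbK => /eqP.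
Qed.

(** Conservation at a vertex with two edge ends makes the two values equal up to sign; squares spare
    the bookkeeping of directions. *)
Lemma eq_sqr_at_vertex C z e1 e2 v : supported C z -> circulation z ->
    sdeg G C v = 2%N -> e1 \in C -> e2 \in C ->
    (src e1 == v) || (tgt e1 == v) -> (src e2 == v) || (tgt e2 == v) ->
  z e1 ^+ 2 = z e2 ^+ 2.
Proof.
move=> zC /(_ v); rewrite (div_supported _ zC) /sdeg.
set A := [set e in C | tgt e == v]; set B := [set e in C | src e == v].
move=> dv dAB e1C e2C i1 i2; have [-> // | ne] := eqVneq e1 e2.
have mB e : e \in C -> src e == v -> e \in B by move=> eC eB; rewrite inE eC.
have mA e : e \in C -> tgt e == v -> e \in A by move=> eC eB; rewrite inE eC.
have cards12 (X Y : {set E}) : e1 \in X -> e2 \in X -> (#|Y| + #|X| = 2)%N ->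
    \sum_(e in X) z e - \sum_(e in Y) z e = z e1 + z e2.
  move=> X1 X2 XY; have s12 : [set e1; e2] \subset X.
    by apply/subsetP => e /set2P [] ->.
  have := subset_leq_card s12; rewrite cards2 ne => leX.
  have Y0 : Y = set0.
    by apply/eqP; rewrite -cards_eq0 -leqn0 -(leq_add2r #|X|) XY.
  have -> : X = [set e1; e2].
    by apply/esym/eqP; rewrite eqEcard s12 cards2 ne -XY leq_addl.
  by rewrite Y0 big_set0 subr0 big_setU1 ?big_set1 // inE.
have cards11 f1 f2 : f1 \in A -> f2 \in B ->
    \sum_(e in A) z e - \sum_(e in B) z e = z f1 - z f2.
  move=> A1 B2; have A1' : (0 < #|A|)%N by apply/card_gt0P; exists f1.
  have B1' : (0 < #|B|)%N by apply/card_gt0P; exists f2.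
  have sing (X : {set E}) f : f \in X -> #|X| = 1%N -> \sum_(e in X) z e = z f.
    move=> fX /eqP /cards1P [g Xg]; rewrite Xg big_set1.
    by move: fX; rewrite Xg => /set1P ->.
  rewrite (sing A f1) ?(sing B f2) //; move: dAB A1' B1'.
    by case: #|A| #|B| => [|[|a]] [|[|b]] //; rewrite !addSn !addnS.
  by case: #|A| #|B| => [|[|a]] [|[|b]] //; rewrite !addSn !addnS.
have opp a b : a + b = 0 -> a ^+ 2 = b ^+ 2 :> R.
  by move/eqP; rewrite addr_eq0 => /eqP ->; rewrite sqrrN.
have same a b : a - b = 0 -> a ^+ 2 = b ^+ 2 :> R.
  by move/eqP; rewrite subr_eq0 => /eqP ->.
case/orP: i1 => i1; case/orP: i2 => i2.
- have BA : (#|A| + #|B| = 2)%N by rewrite addnC.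
  apply: opp; rewrite -(cards12 B A (mB _ e1C i1) (mB _ e2C i2) BA).
  by apply/eqP; rewrite -oppr_eq0 opprB dv.
- by apply/esym/same; rewrite -(cards11 e2 e1) ?mA ?mB.
- by apply/same; rewrite -(cards11 e1 e2) ?mA ?mB.
- by apply: opp; rewrite -(cards12 A B (mA _ e1C i1) (mA _ e2C i2) dAB).
Qed.

Lemma natr_inj0 (m k : nat) : m%:R = k%:R :> R -> m = k.
Proof.
have n0 := (pcharf0P R).1 char0.
wlog le : m k / (m <= k)%N.
  move=> H eq; case/orP: (leq_total m k) => le; first exact: H.
  exact/esym/H/esym.
move=> /esym /eqP; rewrite -subr_eq0 -natrB // n0 subn_eq0 => le2.
by apply/eqP; rewrite eqn_leq le.
Qed.

Lemma ocyc_supported C s : s \subset C -> supported C (ocyc R C s).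
Proof.
move=> sC e eC; rewrite /ocyc (negbTE eC) ifN //.
by apply: contra eC; apply: (subsetP sC).
Qed.

Lemma ocyc_sqr C s e : e \in C -> ocyc R C s e * ocyc R C s e = 1.
Proof. by rewrite /ocyc => ->; case: ifP; rewrite ?mulr1 ?mulrNN ?mulr1. Qed.

(** The divergence of the sign vector is the difference of the two counts in [cyc_orient];
    characteristic zero carries an equality in [R] back to the counts. *)
Lemma cyc_orientP C s : s \subset C ->
  reflect (circulation (ocyc R C s)) (cyc_orient G C s).
Proof.
move=> sC; have divE v : div (ocyc R C s) v =
    (#|[set e in s | tgt e == v]| + #|[set e in C :\: s | src e == v]|)%:R
    - (#|[set e in s | src e == v]| + #|[set e in C :\: s | tgt e == v]|)%:R.
  have sumf (S : {set E}) (f : E -> V) :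
      (#|[set e in S | f e == v]|)%:R = \sum_e (e \in S)%:R * (f e == v)%:R :> R.
    rewrite -sum1_card natr_sum big_mkcond; apply: eq_bigr => e _.
    by rewrite inE; case: (e \in S); case: (f e == v); rewrite ?mulr0 ?mul0r ?mulr1.
  rewrite !natrD !sumf -!big_split -sumrB; apply: eq_bigr => e _ /=.
  rewrite /ocyc /inc inE; have [es | es] := boolP (e \in s).
    by rewrite (subsetP sC) // !mul0r !mul1r !addr0.
  case: (e \in C); rewrite ?mul0r ?addr0 ?subrr // !mul1r !add0r mulN1r opprB.
  by [].
rewrite /cyc_orient sC /=; apply: (iffP forallP) => [H v | H v].
  apply/eqP; rewrite divE subr_eq0; apply/eqP.
  exact: (congr1 (GRing.natmul 1) (eqP (H v))).
have /eqP := H v; rewrite divE subr_eq0 => /eqP /natr_inj0 eqd.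
apply/eqP; exact: eqd.
Qed.

(** A cycle has as many vertices as edges, so it carries a nonzero circulation [z]. Its square is
    constant on the cycle, so [z / z e1] is a vector of signs and gives an orientation. Hence the
    default [set0] is never reached. *)
Lemma cycle_orientation C : simple_cycle G C ->
  let s := odflt set0 [pick s | cyc_orient G C s] in
  s \subset C /\ circulation (ocyc R C s).
Proof.
move=> cC; have [sC C0 conC d2] := simple_cycleP cC.
suff [s0 s0C] : exists s, cyc_orient G C s.
  case: pickP => [s cs | /(_ s0)]; last by rewrite s0C.
  have sC' : s \subset C by case/andP: cs.
  by split=> //; apply/(cyc_orientP sC').
case/set0Pn: (C0) => e0 e0C; have [sv _] := mem_cycle_vertices e0C.
have [||z [zC [e1 ze1] cz]] := @dependent_circulation R V E G C (cycle_vertices C).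
- exact: mem_cycle_vertices.
- by rewrite card_cycle_vertices // leqnn andbT; apply/card_gt0P; exists e0.
have e1C : e1 \in C by apply: contraR ze1 => /zC ->.
have sq e : e \in C -> z e ^+ 2 = z e1 ^+ 2.
  (* All cycle edges at [v] share one square, so any of them decides [phi v], and [phi] is constant
     along the cycle. *)
  pose phi v := [exists e in C, ((src e == v) || (tgt e == v)) && (z e ^+ 2 == z e1 ^+ 2)].
  have phiE e' v : e' \in C -> (src e' == v) || (tgt e' == v) ->
      phi v = (z e' ^+ 2 == z e1 ^+ 2).
    move=> e'C e'v; have vC : v \in cycle_vertices C.
      by case: (mem_cycle_vertices e'C) => ? ?; case/orP: e'v => /eqP <-.
    apply/existsP/idP => [[e2 /and3P [e2C e2v e2z]] | H].
      by rewrite (eq_sqr_at_vertex zC cz (d2 _ vC) e'C e2C).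
    by exists e'; rewrite e'C e'v.
  move=> eC; apply/eqP.
  rewrite -(phiE e (src e)) ?eqxx // -(@connect_const _ _ G _ phi C (src e1)).
  - by rewrite (phiE e1) ?eqxx.
  - by move=> e2 e2C; rewrite !(phiE e2) ?eqxx ?orbT.
  - exact: conC.
pose s := [set e in C | z e == z e1].
have sC' : s \subset C by apply/subsetP => e; rewrite inE => /andP [].
exists s; apply/(cyc_orientP sC') => v.
pose y e := (z e1)^-1 * z e + 0 * z e.
rewrite (@eq_div _ _ _ _ _ y); first by rewrite div_lin cz !mulr0 addr0.
move=> e; rewrite /y mul0r addr0 /ocyc inE; have [eC | /zC ->] := boolP (e \in C).
  rewrite /=; case: eqP => [->|ne]; first by rewrite mulVf.
  have /eqP := sq e eC; rewrite eqf_sqr (introF eqP ne) /= => /eqP ->.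
  by rewrite mulrN mulVf.
by rewrite mulr0.
Qed.

End Cycles.

(** * Cycle contraction, and the circulation given by the cycle polynomial *)

Section Response.
Variables (R : fieldType) (V E : finType) (G : graph V E).
Hypothesis char0 : [pchar R] =i pred0.
Hypothesis wfG : forall e, e \in ges G -> gsrc G e \in gvs G /\ gtgt G e \in gvs G.
Implicit Types (S T C s : {set E}) (u v w : V) (e : E) (z : E -> R).

Local Notation src := (gsrc G).
Local Notation tgt := (gtgt G).
Local Notation inc := (inc R G).
Local Notation div := (div G).
Local Notation circulation := (circulation G).

(** The orientation chosen inside [cyclepoly]; a product of two signs does not depend on the
    choice. *)
Definition cycor C := odflt set0 [pick s | cyc_orient G C s].
Definition osign C : E -> R := ocyc R C (cycor C).

Lemma osign_circulation C : simple_cycle G C -> circulation (osign C).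
Proof. by move=> /(cycle_orientation char0) []. Qed.

Lemma osign_supported C : simple_cycle G C -> supported C (osign C).
Proof. by move=> /(cycle_orientation char0) [sC _]; apply: ocyc_supported. Qed.

Lemma osign_sqr C e : e \in C -> osign C e * osign C e = 1.
Proof. exact: ocyc_sqr. Qed.

Lemma osign_neq0 C e : e \in C -> osign C e != 0.
Proof. by move=> /osign_sqr o2; apply: contra_eq_neq o2 => ->; rewrite mul0r eq_sym oner_eq0. Qed.

Lemma cycle_del_connect C e : simple_cycle G C -> e \in C ->
  connect (adj G (C :\ e)) (src e) (tgt e).
Proof.
move=> cC eC; apply: circulation_connect (osign_supported cC) (osign_circulation cC) _.
exact: osign_neq0.
Qed.

Lemma connect_gvs S u v : S \subset ges G -> u \in gvs G -> connect (adj G S) u v -> v \in gvs G.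
Proof.
move=> /subsetP sS ug /(connect_const (phi := [in gvs G])) /= <- // e /sS /wfG [-> ->] //.
Qed.

(** The [#|C|] vertices of the cycle merge into the single root [r0], and every other vertex is its
    own root. *)
Lemma card_contract C : simple_cycle G C -> (#|gvs (contract G C)| + #|C| = #|gvs G|.+1)%N.
Proof.
move=> cC; have [sC C0 conC d2] := simple_cycleP cC.
rewrite -(card_cycle_vertices cC).
set r := fingraph.root (adj G C).
case/set0Pn: C0 => e0 e0C.
have rE u v : (r u == r v) = connect (adj G C) u v := root_connect (@connect_adjC _ _ G C) u v.
pose r0 := r (src e0).
have conE v : v \in cycle_vertices G C = connect (adj G C) (src e0) v.
  apply/idP/idP => [|].
    rewrite inE -lt0n /sdeg addn_gt0 => /orP [] /card_gt0P [e]; rewrite inE => /andP [eC /eqP <-].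
      exact: conC.
    by rewrite -(connect_edge_eq _ _ eC); apply: conC.
  move=> /(connect_const (phi := [in cycle_vertices G C])) /= <-.
    by case: (mem_cycle_vertices G e0C).
  by move=> e /(mem_cycle_vertices G) [-> ->].
have r0C : r0 \in cycle_vertices G C by rewrite conE connect_root.
have rr0 : r r0 = r0 := root_root (@connect_adjC _ _ G C) _.
have sVC : cycle_vertices G C \subset gvs G.
  apply/subsetP => v; rewrite conE; apply: connect_gvs => //.
  by case: (wfG (subsetP sC _ e0C)).
have isol v : v \notin cycle_vertices G C -> r v = v.
  move=> vC; have : connect (adj G C) v (r v) by apply: connect_root.
  move=> /(connect_const (phi := fun w => w == v)); rewrite eqxx => H.
  have ne w : w \in cycle_vertices G C -> (w == v) = false.
    by move=> wC; apply: contraNF vC => /eqP <-.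
  by apply/eqP; rewrite -H // => e /(mem_cycle_vertices G) [sv tv]; rewrite !ne.
have -> : gvs (contract G C) = r0 |: (gvs G :\: cycle_vertices G C).
  apply/setP => v; rewrite in_setU1 in_setD [LHS]inE -/r.
  have [vC | vC] := boolP (v \in cycle_vertices G C).
    rewrite (subsetP sVC) //= orbF.
    have /eqP <- : r0 == r v by rewrite rE -conE.
    by rewrite eq_sym.
  rewrite isol // eqxx andbT /=.
  by have [vr | //] := eqVneq v r0; rewrite vr r0C in vC.
rewrite cardsU1 in_setD r0C /= add1n addSn cardsD (setIidPr sVC) subnK //.
exact: subset_leq_card.
Qed.

(** The contracted vertex expands to the path [C :\ e], which connects the same vertices as [C].
    Potentials constant along the edges descend to the contraction and lift back through the root
    map; [card_contract] matches the sizes. *)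
Lemma contract_spanning_tree C e T : simple_cycle G C -> e \in C -> T \subset ges G :\: C ->
  spanning_tree (contract G C) T = spanning_tree G (T :|: C :\ e).
Proof.
move=> cC eC sT; have [sC _ _ _] := simple_cycleP cC.
set r := fingraph.root (adj G C).
have cr v : connect (adj G C) v (r v) by apply: connect_root.
have TC e' : e' \in T -> e' \notin C by move/(subsetP sT); rewrite inE => /andP [].
have cardT : (#|T :|: C :\ e| = #|T| + #|C|.-1)%N.
  rewrite cardsU (cardsD1 e C) eC /= (_ : T :&: _ = set0) ?cards0 ?subn0 //.
  by apply/setP => e'; rewrite !inE; case: (boolP (e' \in T)) => // /TC /negbTE ->; rewrite andbF.
have cardE : (#|T|.+1 == #|gvs (contract G C)|)%N = ((#|T :|: C :\ e|).+1 == #|gvs G|)%N.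
  rewrite -(eqn_add2r #|C|) card_contract // cardT -(eqSS _ #|gvs G|) (cardsD1 e C) eC /=.
  by rewrite addSn addnA addn1 addSn.
have sT' : T :|: C :\ e \subset ges G.
  rewrite subUset (subset_trans sT) ?subsetDl //=.
  exact: subset_trans (subsetDl _ _) sC.
apply/spanning_treeP/spanning_treeP => -[_ cT nT]; split=> //.
- move=> u v ug vg; apply: connect_pot => phi phiT.
  have phiC e' : e' \in C -> phi (src e') = phi (tgt e').
    move=> e'C; apply: connect_const (connect_del (cycle_del_connect cC eC) (connect_edge G e'C)).
    by move=> e1 e1C; apply: phiT; rewrite inE e1C orbT.
  have phir w : phi w = phi (r w) by apply: connect_const (cr w).
  have rg w : w \in gvs G -> r w \in gvs (contract G C).
    move=> wg; rewrite inE (connect_gvs sC wg (cr w)) /=.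
    exact/eqP/(root_root (@connect_adjC _ _ G C)).
  rewrite phir (phir v); apply: connect_const (cT _ _ (rg _ ug) (rg _ vg)).
  by move=> e' e'T /=; rewrite -!phir phiT // inE e'T.
- by apply/eqP; rewrite -cardE; apply/eqP.
- move=> u v; rewrite !inE => /andP [ug /eqP ru] /andP [vg /eqP rv].
  apply: connect_pot => phi phiT; rewrite -ru -rv.
  apply: (connect_const (phi := phi \o r)) (cT _ _ ug vg) => e' /setUP [/phiT // | ].
  case/setD1P=> _ /(connect_edge G) ce; rewrite /=; congr phi; apply/eqP.
  by rewrite (root_connect (@connect_adjC _ _ G C)).
- by apply/eqP; rewrite cardE; apply/eqP.
Qed.

(** Existence is the support of the circulation from [tree_fundamental]. For uniqueness, the sign
    vector of any such cycle minus the multiple of [z] with the same value at [e] lives on the tree,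
    hence vanishes. *)
Lemma fundamental_cycle T e : spanning_tree G T -> e \in ges G -> e \notin T ->
  exists2 C, [/\ simple_cycle G C, e \in C & C :\ e \subset T]
    & forall C', simple_cycle G C' -> e \in C' -> C' :\ e \subset T -> C' = C.
Proof.
move=> tT eg eT; have [z [zT cz ze]] := tree_fundamental R wfG tT eg eT.
have ze0 : z e != 0 by rewrite ze oner_eq0.
exists [set e' | z e' != 0].
  split; [exact: support_simple_cycle tT eg eT zT cz ze0 | by rewrite inE|].
  apply/subsetP => e'; rewrite !inE => /andP [ne]; apply: contraR => e'T.
  by rewrite zT // !inE negb_or ne.
move=> C cC eC sC; pose d f := 1 * osign C f + (- osign C e) * z f.
have d0 : d =1 fun=> 0.
  apply: (tree_circulation tT).
    move=> f fT; rewrite /d; have [->|ne] := eqVneq f e.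
      by rewrite ze mul1r mulr1 subrr.
    rewrite zT ?inE ?negb_or ?ne // mulr0 addr0 (osign_supported cC) ?mulr0 //.
    by apply: contra fT => fC; apply: (subsetP sC); rewrite !inE ne.
  by move=> v; rewrite div_lin cz osign_circulation // !mulr0 addr0.
have oE f : osign C f = osign C e * z f.
  by apply/eqP; rewrite -subr_eq0 -mulNr -[X in X + _]mul1r; apply/eqP/d0.
apply/setP => f; rewrite inE; apply/idP/idP => [fC | zf].
  by apply: contra_neq (osign_neq0 fC) => zf; rewrite oE zf mulr0.
apply: contraR zf => fC; have := osign_supported cC fC; rewrite oE => /eqP.
by rewrite mulf_eq0 (negbTE (osign_neq0 eC)).
Qed.

Lemma div_sum (I : finType) (P : pred I) (c : I -> R) (y : I -> E -> R) v :
  div (fun e => \sum_(i | P i) c i * y i e) v = \sum_(i | P i) c i * div (y i) v.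
Proof.
rewrite /div; under eq_bigr do rewrite mulr_suml.
rewrite exchange_big; apply: eq_bigr => i _ /=; rewrite mulr_sumr.
by apply: eq_bigr => e _; rewrite mulrA.
Qed.

(** Both sides are circulations with equal values outside [T]. The inner sum has one term, the
    fundamental cycle of [e]; writing it as a sum over [C] prepares the exchange of summations in
    [cycle_response]. *)
Lemma fundamental_decomposition T z f : spanning_tree G T -> circulation z ->
    supported (ges G) z -> f \in ges G ->
  \sum_(e in ges G :\: T) \sum_(C | [&& simple_cycle G C, e \in C & C :\ e \subset T])
     z e * osign C e * osign C f = z f.
Proof.
move=> tT cz zg fg.
pose y f := \sum_(e in ges G :\: T) z e *
  \sum_(C | [&& simple_cycle G C, e \in C & C :\ e \subset T]) osign C e * osign C f.
pose d f := 1 * z f + (-1) * y f.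
have /(tree_circulation tT) d0 : supported T d.
  move=> g gT; have [gg | gg] := boolP (g \in ges G); last first.
    rewrite /d zg // /y mulr0 add0r big1 ?mulr0 // => e _.
    rewrite big1 ?mulr0 // => C /and3P [cC _ _]; rewrite [osign C g](osign_supported cC) ?mulr0 //.
    by apply: contra gg; have [/subsetP sC _ _ _] := simple_cycleP cC; apply: sC.
  rewrite /d /y (bigD1 g) ?inE ?gT //= [X in _ * (_ + X)]big1 ?addr0.
    have [C [cC gC sC] uC] := fundamental_cycle tT gg gT.
    rewrite (big_pred1 C) ?osign_sqr ?mulr1 ?mul1r ?mulN1r ?subrr // => C' /=.
    apply/and3P/eqP => [[cC' gC' sC'] | ->]; last by split.
    exact: uC.
  move=> e /andP [_ ne]; rewrite big1 ?mulr0 // => C /and3P [cC _ /subsetP sC].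
  rewrite [osign C g](osign_supported cC) ?mulr0 //; apply: contra gT => gC.
  by apply: sC; rewrite !inE eq_sym ne.
have /d0 /(_ f) : circulation d.
  move=> v; rewrite div_lin cz mulr0 add0r div_sum big1 ?mulr0 // => e _.
  by rewrite div_sum big1 ?mulr0 // => C /and3P [cC _ _]; rewrite osign_circulation // mulr0.
rewrite /d mul1r mulN1r => /eqP; rewrite subr_eq0 => /eqP ->.
apply: eq_bigr => e _; rewrite mulr_sumr; apply: eq_bigr => C _.
by rewrite mulrA.
Qed.

(* A spanning tree of G//C together with an edge e of C amounts to a spanning tree T of G
   and an edge e outside T whose fundamental cycle is C. *)
Lemma cycle_response (alpha z : E -> R) f : circulation z -> supported (ges G) z -> f \in ges G ->
  \sum_e alpha e * z e * cyclepoly G alpha e f = Kirchhoff G alpha * z f.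
Proof.
move=> cz zg fg.
pose w T := \prod_(e in ges G :\: T) alpha e.
transitivity (\sum_(C | simple_cycle G C) \sum_(e in C)
    \sum_(T | [&& spanning_tree G T, C :\ e \subset T & e \in ges G :\: T])
      w T * (z e * osign C e * osign C f)).
  transitivity (\sum_e \sum_(C | simple_cycle G C) alpha e * z e *
     (osign C e * osign C f * Kirchhoff (contract G C) alpha)).
    by apply: eq_bigr => e _; rewrite -mulr_sumr.
  rewrite exchange_big; apply: eq_bigr => C cC /=.
  have [sC _ _ _] := simple_cycleP cC.
  rewrite (bigID [in C]) /= [X in _ + X]big1 ?addr0; last first.
    by move=> e eC; rewrite (osign_supported cC eC) !mul0r mulr0.
  apply: eq_bigr => e eC; rewrite /Kirchhoff !mulr_sumr.
  (* A tree [T] of [G] containing [C :\ e] but not [e] corresponds to the tree [T :\: C] of the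
     contraction. *)
  rewrite (reindex_onto (fun T => T :\: C) (fun T => T :|: C :\ e)) /=; last first.
    move=> T /and3P [/subsetP sT _ _]; apply/setP => e'; rewrite !inE.
    have [e'T | _] := boolP (e' \in T).
      by have := sT _ e'T; rewrite inE => /andP [-> _].
    by case: (e' \in C); rewrite ?andbF.
  have TE T : (spanning_tree (contract G C) (T :\: C) && (T :\: C :|: C :\ e == T)) =
      [&& spanning_tree G T, C :\ e \subset T & e \in ges G :\: T].
    have [TC | TC] := eqVneq (T :\: C :|: C :\ e) T; last first.
      rewrite andbF; apply/esym/negP => /and3P [_ /subsetP sCT].
      rewrite inE => /andP [eT _]; case/eqP: TC; apply/setP => e'; rewrite !inE.
      have [e'T | e'T] := boolP (e' \in T).
        case: (e' \in C); rewrite //= andbT.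
        by apply: contraNneq eT => <-.
      by rewrite andbF; apply: contraNF e'T => H; apply: sCT; rewrite !inE.
    have sCT : C :\ e \subset T by rewrite -TC subsetUr.
    have eT : e \notin T by rewrite -TC !inE eC eqxx.
    rewrite andbT sCT inE eT (subsetP sC) //= andbT.
    have [sTg | sTg] := boolP (T :\: C \subset ges G :\: C).
      by rewrite (contract_spanning_tree cC eC sTg) TC.
    apply/idP/idP => [/and3P [sTC _ _] | /and3P [sT _ _]]; first by rewrite sTC in sTg.
    by rewrite setSD in sTg.
  apply: eq_big => T; first exact: TE.
  rewrite TE => /and3P [_ /subsetP sCT eT].
  have -> : w T = alpha e * \prod_(e' in ges G :\: C :\: (T :\: C)) alpha e'.
    rewrite /w (bigD1 e) //=; congr (_ * _); apply: eq_bigl => e'.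
    rewrite !inE; have [-> | ne] := eqVneq e' e; first by rewrite eC andbF.
    rewrite andbT; have [e'C | e'C] := boolP (e' \in C) => //=.
    by rewrite sCT // !inE ne.
  set p := \prod_(_ in _) _; rewrite -[X in _ * (_ * X)]/p -/(osign C).
  by rewrite -!mulrA; congr (_ * _); rewrite [RHS]mulrC -!mulrA.
transitivity (\sum_(T | spanning_tree G T) w T * z f); last by rewrite /Kirchhoff mulr_suml.
transitivity (\sum_(T | spanning_tree G T) \sum_(e in ges G :\: T)
    \sum_(C | [&& simple_cycle G C, e \in C & C :\ e \subset T])
      w T * (z e * osign C e * osign C f)); last first.
  apply: eq_bigr => T tT; rewrite -[in RHS](fundamental_decomposition tT cz zg fg).
  by rewrite mulr_sumr; apply: eq_bigr => e _; rewrite mulr_sumr.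
pose F T e C := w T * (z e * osign C e * osign C f).
transitivity (\sum_C \sum_e \sum_T
   if [&& simple_cycle G C, e \in C, spanning_tree G T, C :\ e \subset T & e \in ges G :\: T]
   then F T e C else 0).
  rewrite big_mkcond; apply: eq_bigr => C _; case: simple_cycle => /=; last first.
    by rewrite big1 // => e _; rewrite big1.
  rewrite big_mkcond; apply: eq_bigr => e _; case: (e \in C) => /=; last by rewrite big1.
  by rewrite big_mkcond.
rewrite [RHS]big_mkcond exchange_big /=.
under eq_bigr do rewrite exchange_big /=.
rewrite exchange_big /=; apply: eq_bigr => T _.
case tT: (spanning_tree G T); last first.
  by rewrite big1 // => e _; rewrite big1 // => C _; rewrite !andbF.
rewrite [RHS]big_mkcond; apply: eq_bigr => e _.
case eT: (e \in ges G :\: T); last by rewrite big1 // => C _; rewrite !andbF.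
by rewrite [RHS]big_mkcond; apply: eq_bigr => C _; rewrite andbT.
Qed.

Lemma cyclepoly_sym (alpha : E -> R) e f : cyclepoly G alpha e f = cyclepoly G alpha f e.
Proof. by apply: eq_bigr => C _; rewrite /= [in RHS](mulrC (ocyc _ _ _ f)). Qed.

Lemma cyclepoly_circulation (alpha : E -> R) f : circulation (cyclepoly G alpha ^~ f).
Proof.
move=> v; rewrite -[RHS](_ : \sum_(C | simple_cycle G C)
    (osign C f * Kirchhoff (contract G C) alpha) * div (osign C) v = 0).
  rewrite -div_sum; apply: eq_div => e; apply: eq_bigr => C _ /=.
  by rewrite [RHS]mulrC mulrA.
by rewrite big1 // => C cC; rewrite osign_circulation // mulr0.
Qed.

(** Testing [z] against the circulation [cyclepoly G alpha ^~ f] returns [Kirchhoff G alpha * z f],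
    so the form is nondegenerate on circulations. *)
Lemma circulation_eq0 (alpha z : E -> R) : ges G = [set: E] -> Kirchhoff G alpha != 0 ->
  circulation z -> (forall y, circulation y -> \sum_e alpha e * y e * z e = 0) ->
  z =1 fun=> 0.
Proof.
move=> gT K0 cz orth f; apply/eqP; rewrite -(mulrI_eq0 _ (mulfI K0)); apply/eqP.
rewrite -cycle_response ?gT ?inE //; last by move=> e; rewrite inE.
rewrite -[RHS](orth _ (cyclepoly_circulation alpha f)); apply: eq_bigr => e _.
by rewrite -!mulrA (mulrC (z e)).
Qed.

End Response.

(** * The flow between the external vertices *)

Section ExternalFlow.
Variables (R : fieldType) (V E : finType) (G : graph V E).
Hypothesis wfG : forall e, e \in ges G -> gsrc G e \in gvs G /\ gtgt G e \in gvs G.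
Variables (x y : V).
Hypotheses (xG : x \in gvs G) (yG : y \in gvs G).
Implicit Types (S T F : {set E}) (u v w : V) (e : E) (z : E -> R).

Local Notation src := (gsrc G).
Local Notation tgt := (gtgt G).
Local Notation inc := (inc R G).
Local Notation div := (div G).
Local Notation circulation := (circulation G).

(** The conditions of [Phi2] without the one on [a], so that both terms of [xedge] become sums over
    the same forests. *)
Definition forest2 F := [&& F \subset ges G, #|F|.+2 == #|gvs G|,
  [forall v in gvs G, connect (adj G F) x v || connect (adj G F) y v]
  & ~~ connect (adj G F) x y].

(** The signed crossing number of [e] from the rest of the graph into the tree of [y]. *)
Definition jump F e : R :=
  (connect (adj G F) (tgt e) y)%:R - (connect (adj G F) (src e) y)%:R.

Lemma Phi2_forest2 (alpha : E -> R) v : Phi2 G alpha x v y =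
  \sum_(F | forest2 F) (\prod_(e in ges G :\: F) alpha e) * (connect (adj G F) v y)%:R.
Proof.
rewrite /Phi2 [LHS]big_mkcond [RHS]big_mkcond; apply: eq_bigr => F _.
rewrite /forest2; case: (F \subset ges G) => //=; case: eqP => //= _.
case: [forall v in _, _] => //=; case: (connect _ x y) => //=.
by case: connect; rewrite ?mulr1 ?mulr0.
Qed.

Lemma xedge_forest2 (alpha : E -> R) e : xedge G alpha x y e =
  (alpha e)^-1 * \sum_(F | forest2 F) (\prod_(e in ges G :\: F) alpha e) * jump F e.
Proof.
rewrite /xedge !Phi2_forest2 -sumrB; congr (_ * _).
by apply: eq_bigr => F _; rewrite -mulrBr.
Qed.

Lemma jump_mem F e : e \in F -> jump F e = 0.
Proof.
move=> eF; rewrite /jump -!(connect_adjC _ _ y) // (connect_edge_eq _ _ eF).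
by rewrite subrr.
Qed.

Lemma forest2_add F e : forest2 F -> e \in ges G -> e \notin F -> jump F e != 0 ->
  spanning_tree G (e |: F).
Proof.
case/and4P=> sF /eqP nF /forallP cF nxy eg eF je.
apply/spanning_treeP; split.
- by rewrite subUset sub1set eg.
- have [sg tg] := wfG eg.
  move=> u v ug vg; apply: connect_pot => phi phiF.
  have phiF' e' : e' \in F -> phi (src e') = phi (tgt e').
    by move=> e'F; apply: phiF; rewrite inE e'F orbT.
  have pe : phi (src e) = phi (tgt e) by apply: phiF; rewrite setU11.
  have con w : w \in gvs G -> phi w = phi x \/ connect (adj G F) w y /\ phi w = phi y.
    move=> wg; have := cF w; rewrite wg /= => /orP [] c; [left | right].
      by rewrite (connect_const phiF' c).
    by rewrite (connect_const phiF' c) connect_adjC.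
  have phix w : w \in gvs G -> ~~ connect (adj G F) w y -> phi w = phi x.
    by move=> wg nw; case: (con w wg) => // -[cw]; rewrite cw in nw.
  have phiy w : connect (adj G F) w y -> phi w = phi y := connect_const phiF'.
  have xy : phi x = phi y.
    move: je; rewrite /jump.
    case: (boolP (connect _ (tgt e) y)) => ct; case: (boolP (connect _ (src e) y)) => cs;
      rewrite ?subrr ?eqxx // => _.
    + by rewrite -(phiy _ ct) -pe phix.
    + by rewrite -(phiy _ cs) pe phix.
  have phiE w : w \in gvs G -> phi w = phi x by case/con => // -[_]; rewrite -xy.
  by rewrite !phiE.
- by rewrite cardsU1 eF -nF.
Qed.

Lemma tree_del_forest2 T e : spanning_tree G T -> e \in T ->
  forest2 (T :\ e) = ~~ connect (adj G (T :\ e)) x y.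
Proof.
move=> tT eT; have [sT cT nT] := spanning_treeP _ _ tT.
rewrite /forest2 (subset_trans _ sT) ?subsetDl //= -nT (cardsD1 e T) eT /= eqxx /=.
case: (boolP (connect _ x y)) => nxy; rewrite ?andbF // andbT.
apply/forallP => v; apply/implyP => vg; apply/negPn/negP; rewrite negb_or => /andP [nxv nyv].
(* the three classes of x, y and v are disjoint, and e must cross each of them *)
have cross a b : a \in gvs G -> b \in gvs G -> ~~ connect (adj G (T :\ e)) a b ->
    connect (adj G (T :\ e)) a (src e) != connect (adj G (T :\ e)) a (tgt e).
  move=> ag bg nab; apply: contra nab => /eqP eqe.
  rewrite -(@connect_const _ _ G _ (connect (adj G (T :\ e)) a) T a b) ?connect0 //; last exact: cT.
  move=> e' e'T; have [->|ne] := eqVneq e' e; first exact: eqe.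
  by apply: connect_edge_eq; rewrite !inE ne.
have symc := connect_adjC G (T :\ e).
have excl a b w : ~~ connect (adj G (T :\ e)) a b ->
    ~~ (connect (adj G (T :\ e)) a w && connect (adj G (T :\ e)) b w).
  move=> nab; apply: contra nab => /andP [aw bw].
  by apply: connect_trans aw _; rewrite symc.
have Cx := cross _ _ xG yG nxy.
have nyx : ~~ connect (adj G (T :\ e)) y x by rewrite symc.
have nvx : ~~ connect (adj G (T :\ e)) v x by rewrite symc.
have nvy : ~~ connect (adj G (T :\ e)) v y by rewrite symc.
have Cy := cross _ _ yG xG nyx.
have Cv := cross _ _ vg xG nvx.
have := excl _ _ (src e) nxy; have := excl _ _ (tgt e) nxy.
have := excl _ _ (src e) nxv; have := excl _ _ (tgt e) nxv.
have := excl _ _ (src e) nyv; have := excl _ _ (tgt e) nyv.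
move: Cx Cy Cv.
move: (connect _ x (src e)) (connect _ x (tgt e)) => bx cx.
move: (connect _ y (src e)) (connect _ y (tgt e)) => by' cy.
move: (connect _ v (src e)) (connect _ v (tgt e)) => bv cv.
by case: bx; case: cx; case: by'; case: cy; case: bv; case: cv.
Qed.

(** The unit flow from [x] to [y] inside a tree is unique. It is carried by the edges whose deletion
    separates [x] from [y], and its value there is the jump. *)
Lemma tree_path_flow T v : spanning_tree G T ->
  \sum_(e in T | forest2 (T :\ e)) jump (T :\ e) e * inc e v = (y == v)%:R - (x == v)%:R.
Proof.
move=> tT; have [sT cT nT] := spanning_treeP _ _ tT.
have [p [pT dp]] := connect_flow R (cT _ _ xG yG).
rewrite -dp /div [RHS](bigID [in T]) /= [X in _ + X]big1 ?addr0; last first.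
  by move=> e /pT ->; rewrite mul0r.
rewrite big_mkcondr; apply: eq_bigr => e eT.
rewrite tree_del_forest2 //; case: ifPn => [nxy | /negPn cxy].
  congr (_ * _).
  (* The cut gives [p e * jump = 1], and a jump is 0, 1 or -1, so [p e] equals the jump. *)
  have := @cut_flow R V E G T e p x y (fun w => connect (adj G (T :\ e)) w y) pT dp.
  rewrite connect0 (negbTE nxy) subr0 -/(jump _ _) => pj.
  have /pj : forall e', e' \in T :\ e -> connect (adj G (T :\ e)) (src e') y
      = connect (adj G (T :\ e)) (tgt e') y.
    by move=> e' e'T; rewrite -!(connect_adjC _ _ y) (connect_edge_eq _ _ e'T).
  rewrite /jump; do 2!case: connect => //=; rewrite ?subrr ?subr0 ?sub0r ?mulr0 ?mulr1 //.
  - by move/eqP; rewrite eq_sym oner_eq0.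
  - by rewrite mulrN1 => <-; rewrite opprK.
  - by move/eqP; rewrite eq_sym oner_eq0.
(* A flow from [x] to [y] that avoids [e] must equal [p], so [p e = 0]. *)
have [q [qT dq]] := connect_flow R cxy.
pose d e := 1 * p e + (-1) * q e.
have /(_ e) : d =1 fun=> 0.
  apply: (tree_circulation tT) => [e' e'T | w].
    by rewrite /d pT // qT ?mulr0 ?addr0 // !inE negb_and e'T orbT.
  by rewrite div_lin dp dq mul1r mulN1r subrr.
by rewrite /d qT ?mulr0 ?addr0 ?mul1r => [->|]; rewrite ?mul0r // !inE eqxx.
Qed.

(** A forest with an edge [e] across it is regrouped as a tree [T = e |: F] with [e] in [T]. The
    factor [(alpha e)^-1] turns the weight of [F] into that of [T], and each tree then contributes
    its unit flow from [x] to [y]. *)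
Lemma div_xedge (alpha : E -> R) v : ges G = [set: E] -> (forall e, alpha e != 0) ->
  div (xedge G alpha x y) v = Kirchhoff G alpha * ((y == v)%:R - (x == v)%:R).
Proof.
move=> gT a0; pose w T := \prod_(e in ges G :\: T) alpha e.
transitivity (\sum_e \sum_(T | spanning_tree G T && ((e \in T) && forest2 (T :\ e)))
    w T * (jump (T :\ e) e * inc e v)).
  apply: eq_bigr => e _; rewrite xedge_forest2 mulr_sumr mulr_suml.
  rewrite (bigID (fun F => e \in F)) /= big1 ?add0r; last first.
    by move=> F /andP [_ /jump_mem ->]; rewrite !mulr0 mul0r.
  rewrite (reindex_onto (fun T => T :\ e) (fun F => e |: F)) /=; last first.
    by move=> F /andP [_ eF]; rewrite setU1K.
  rewrite (eq_bigl (fun T => (e \in T) && forest2 (T :\ e))); last first.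
    move=> T; rewrite !inE eqxx andbT andbC; congr (_ && _).
    by apply/eqP/idP => [<- | /setD1K //]; rewrite setU11.
  rewrite [LHS]big_mkcond [RHS]big_mkcond; apply: eq_bigr => T _.
  case: (boolP (e \in T)) => eT /=; last by rewrite andbF.
  case: (boolP (forest2 (T :\ e))) => fT /=; last by rewrite andbF.
  rewrite andbT; case: ifPn => tT.
    have eTe : e \notin T :\ e by rewrite !inE eqxx.
    have -> : \prod_(e0 in ges G :\: (T :\ e)) alpha e0 = alpha e * w T.
      rewrite (bigD1 e) /= ?inE ?eqxx ?gT ?inE //; congr (_ * _); apply: eq_bigl => e'.
      rewrite !in_setD in_set1; have [->|ne] := eqVneq e' e; first by rewrite eT andbF.
      by rewrite /= andbT gT.
    by rewrite -!mulrA mulKf.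
  have [-> | je] := eqVneq (jump (T :\ e) e) 0; first by rewrite !mulr0 mul0r.
  case/negP: tT; rewrite -(setD1K eT); apply: forest2_add; rewrite ?setU11 //.
  - by rewrite gT inE.
  - by rewrite !inE eqxx.
rewrite (exchange_big_dep (spanning_tree G)) /=; last by move=> e T _ /andP [].
rewrite /Kirchhoff mulr_suml; apply: eq_bigr => T tT.
rewrite -(tree_path_flow v tT) -/(w T) mulr_sumr; apply: eq_bigl => e.
by rewrite tT.
Qed.

End ExternalFlow.

(** * The rank one relation between the cycle polynomials before and after identification *)

Section RankOne.
Variables (R : fieldType) (V E : finType) (src tgt : E -> V) (x y : V).
Variable (alpha : E -> R).
Hypothesis char0 : [pchar R] =i pred0.
Let Gam := Graph [set: V] [set: E] src tgt.
Let Gbul := identify Gam x y.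
Hypotheses (xy : x != y) (a0 : forall e, alpha e != 0).
Hypotheses (K0 : Kirchhoff Gam alpha != 0) (Kb0 : Kirchhoff Gbul alpha != 0).

Let wfGbul e : e \in ges Gbul -> gsrc Gbul e \in gvs Gbul /\ gtgt Gbul e \in gvs Gbul.
Proof.
have fG v : (if v == y then x else v) \in gvs Gbul by rewrite !inE andbT; case: ifPn.
by split; apply: fG.
Qed.

(** The vertex type is kept, so [y] stays behind as an isolated point and its divergence moves to
    [x]. *)
Lemma div_identify (z : E -> R) v : div Gbul z v =
  if v == y then 0 else div Gam z v + (v == x)%:R * div Gam z y.
Proof.
have incE e : inc R Gbul e v =
    if v == y then 0 else inc R Gam e v + (v == x)%:R * inc R Gam e y.
  have end_ w : ((if w == y then x else w) == v)%:R =
      if v == y then 0 else (w == v)%:R + (v == x)%:R * (w == y)%:R :> R.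
    have [->|vy] := eqVneq v y.
      by case: ifPn => [_ | /negbTE ->] //; rewrite (negbTE xy).
    have [->|wy] := eqVneq w y; last by rewrite mulr0 addr0.
    by rewrite mulr1 (eq_sym y) (negbTE vy) add0r eq_sym.
  rewrite /inc /= !end_; case: (v == y); first by rewrite subrr.
  by rewrite mulrBr opprD addrACA.
rewrite /div; under eq_bigr do rewrite incE.
case: (v == y); first by rewrite big1 // => e _; rewrite mulr0.
rewrite mulr_sumr -big_split; apply: eq_bigr => e _ /=.
by rewrite mulrDr (mulrCA _ (z e)).
Qed.

(** Spanning trees of the quotient are the two-tree forests separating [x] and [y]: if [F] joined
    [x] to [y], it would connect all of [Gam] with one edge too few. *)
Lemma Kirchhoff_identify : Kirchhoff Gbul alpha = Phi2 Gam alpha x y y.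
Proof.
rewrite Phi2_forest2 /Kirchhoff; apply: eq_big => F; last by rewrite connect0 mulr1.
have cardV : #|gvs Gam| = #|gvs Gbul|.+1 by rewrite (cardsD1 y) inE.
pose f v := if v == y then x else v.
apply/spanning_treeP/and4P => [[sF cF nF] | [sF nF cF nxy]].
  split=> //; first by rewrite cardV eqSS nF.
    pose phi v := connect (adj Gam F) x v || connect (adj Gam F) y v.
    have phif v : phi (f v) = phi v.
      by rewrite /f; case: eqP => // ->; rewrite /phi !connect0 orbT.
    have phiF e : e \in F -> phi (f (src e)) = phi (f (tgt e)).
      by move=> eF; rewrite !phif /phi !(@connect_edge_eq _ _ Gam F e _ eF).
    apply/forallP => v; apply/implyP => _; rewrite -/(phi v) -phif.
    have <- : phi x = phi (f v); last by rewrite /phi connect0.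
    apply: (@connect_const _ _ Gbul _ phi F); first exact: phiF.
    by apply: cF; rewrite !inE ?xy //= andbT /f; case: ifPn.
  apply/negP => cxy; have := @card_connected R V E Gam F (gvs Gam).
  rewrite cardV -nF ltnn => H; suff : false by []; apply: H => u v _ _.
  apply: connect_pot => phi phiF.
  have xy' : phi x = phi y := connect_const phiF cxy.
  pose g v := if v == y then x else v.
  have phig w : phi (g w) = phi w by rewrite /g; case: eqP => // ->.
  have gG w : g w \in gvs Gbul by rewrite !inE andbT /g; case: ifPn.
  rewrite -(phig u) -(phig v); apply: connect_const (cF _ _ (gG u) (gG v)) => e eF.
  by rewrite /= -!/(g _) !phig phiF.
split=> //; last by move: nF; rewrite cardV eqSS => /eqP.
move=> u v ug vg; apply: connect_pot => phi phiF.
have phix w : phi (f w) = phi x.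
  have [/orP[] c] : connect (adj Gam F) x w || connect (adj Gam F) y w.
  - by move/forallP: cF => /(_ w); rewrite inE.
  - by have /= <- := @connect_const _ _ Gam _ (phi \o f) F x w phiF c; rewrite /f (negbTE xy).
  - by have /= <- := @connect_const _ _ Gam _ (phi \o f) F y w phiF c; rewrite /f eqxx.
have fE w : w \in gvs Gbul -> f w = w by rewrite !inE andbT /f => /negbTE ->.
by rewrite -(fE u) // -(fE v) // !phix.
Qed.

(** For fixed [f] the difference [w] of the two sides is a circulation of [Gbul]. Each circulation
    of [Gbul] is [z0 + c X] with [z0] a circulation of [Gam], and [w] pairs to zero with both
    summands. *)
Lemma cyclepoly_identify e f :
  cyclepoly Gbul alpha e f = Kirchhoff Gbul alpha / Kirchhoff Gam alpha * cyclepoly Gam alpha e f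
    + (Kirchhoff Gam alpha)^-1 * (xedge Gam alpha x y e * xedge Gam alpha x y f).
Proof.
set K := Kirchhoff Gam alpha; set Kb := Kirchhoff Gbul alpha.
pose X := xedge Gam alpha x y.
have dX v : div Gam X v = K * ((y == v)%:R - (x == v)%:R).
  by apply: div_xedge; rewrite ?inE.
have yx : (y == x) = false by rewrite eq_sym (negbTE xy).
have circb (z : E -> R) : circulation Gam z -> circulation Gbul z.
  by move=> cz v; rewrite div_identify !cz mulr0 addr0 if_same.
have cXb : circulation Gbul X.
  move=> v; rewrite div_identify !dX eqxx (negbTE xy) subr0 mulr1.
  have [//|vy] := eqVneq v y; rewrite sub0r.
  by rewrite (eq_sym x v); case: eqP => _; rewrite ?mulrN1 ?mul1r ?addNr // oppr0 mulr0 mul0r addr0.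
(* alpha * X is a potential difference, hence orthogonal to the circulations of Gam *)
have green_X (z : E -> R) : \sum_e alpha e * z e * X e = \sum_v Phi2 Gam alpha x v y * div Gam z v.
  rewrite green; apply: eq_bigr => e' _; rewrite /X /xedge.
  by rewrite mulrAC mulrA mulfV // mul1r mulrC.
have orthX (z : E -> R) : circulation Gam z -> \sum_e alpha e * z e * X e = 0.
  by move=> cz; rewrite green_X big1 // => v _; rewrite cz mulr0.
(* The energy of the flow [X]: only [x] and [y] have divergence, the potential is zero at [x] and
   [Kb] at [y]. *)
have XX : \sum_e alpha e * X e * X e = K * Kb.
  rewrite green_X (bigD1 y) //= (bigD1 x) //= big1 ?addr0; last first.
    move=> v /andP [vy vx]; rewrite dX (eq_sym y v) (negbTE vy) (eq_sym x v) (negbTE vx).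
    by rewrite subrr !mulr0.
  rewrite !dX !eqxx yx (negbTE xy) subr0 mulr1 -Kirchhoff_identify -/Kb mulrC.
  rewrite [X in _ + X * _](_ : _ = 0) ?mul0r ?addr0 //.
  by rewrite Phi2_forest2 big1 // => F /and4P [_ _ _ /negbTE ->]; rewrite mulr0.
pose w e := 1 * cyclepoly Gbul alpha e f
  + (-1) * (Kb / K * cyclepoly Gam alpha e f + (K^-1 * X f) * X e).
suff /(_ e) : w =1 fun=> 0.
  rewrite /w mul1r mulN1r => /eqP; rewrite subr_eq0 => /eqP ->.
  by congr (_ + _); rewrite -mulrA; congr (_ * _); apply: mulrC.
have cG : circulation Gam (cyclepoly Gam alpha ^~ f) := cyclepoly_circulation _ char0 _ _.
have cB : circulation Gbul (cyclepoly Gbul alpha ^~ f) := cyclepoly_circulation _ char0 _ _.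
have respG (z : E -> R) : circulation Gam z -> \sum_e alpha e * z e * cyclepoly Gam alpha e f = K * z f.
  by move=> cz; apply: cycle_response; rewrite ?inE // => e'; rewrite inE.
have respB (z : E -> R) : circulation Gbul z -> \sum_e alpha e * z e * cyclepoly Gbul alpha e f = Kb * z f.
  by move=> cz; apply: cycle_response; rewrite ?inE // => e'; rewrite inE.
apply: (@circulation_eq0 R V E Gbul char0 wfGbul alpha w (erefl _) Kb0).
- move=> v; rewrite div_lin cB div_lin cXb (circb _ cG) !mulr0 addr0 mulr0 addr0 //.
- move=> z cz.
  (* This [c] cancels the divergence of [z] at [y]; being closed in [Gbul], [z] has the opposite
     divergence at [x]. *)
  pose c := div Gam z y / K; pose z0 e := 1 * z e + (- c) * X e.
  have cz0 : circulation Gam z0.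
    move=> v; rewrite div_lin dX mul1r.
    have := cz v; rewrite div_identify; have [->|vy] := eqVneq v y.
      by rewrite (negbTE xy) subr0 mulr1 mulNr divfK // subrr.
    rewrite sub0r (eq_sym x v).
    case: eqP => _ /eqP.
      by rewrite mul1r mulrN1 mulrNN divfK // => /eqP.
    by rewrite mul0r addr0 oppr0 !mulr0 addr0 => /eqP.
  have zE e' : z e' = z0 e' + c * X e' by rewrite /z0 mul1r mulNr subrK.
  have -> : \sum_e alpha e * z e * w e =
     \sum_e alpha e * z e * cyclepoly Gbul alpha e f
     - Kb / K * (\sum_e alpha e * z0 e * cyclepoly Gam alpha e f
                 + c * \sum_e alpha e * cyclepoly Gam alpha e f * X e)
     - K^-1 * X f * (\sum_e alpha e * z0 e * X e + c * \sum_e alpha e * X e * X e).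
    rewrite !mulr_sumr -!big_split /= !mulr_sumr -!sumrB; apply: eq_bigr => e' _.
    rewrite /w zE; ring.
  rewrite respB // respG // (orthX _ cG) (orthX _ cz0) XX zE; field.
  exact: K0.
Qed.

End RankOne.

(** * Partitions and colourings *)

Section Colourings.
Variable (W : finType).
Implicit Types (Pt : {set {set W}}).

Lemma preim_partitionE (T : eqType) (f : W -> T) Pt : partition Pt [set: W] ->
  reflect (forall w z, (f w == f z) = (pblock Pt w == pblock Pt z))
    (preim_partition f [set: W] == Pt).
Proof.
move=> pPt; have /and3P [cPt tPt _] := pPt.
apply: (iffP eqP) => [<- w z | H].
  have /and3P [/eqP cf tf _] := preim_partitionP f [set: W].
  rewrite eq_pblock ?cf ?inE // pblock_equivalence_partition ?inE //.
  by split=> // /eqP ->.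
rewrite -[RHS](preim_partition_pblock pPt) /preim_partition /equivalence_partition.
by apply: eq_imset => w; apply/setP => z; rewrite !inE H.
Qed.

(** A colouring whose colour classes are the blocks is an injection of the blocks into the
    colours. *)
Lemma card_colourings_of_partition q Pt : partition Pt [set: W] ->
  #|[set f : {ffun W -> 'I_q} | preim_partition f [set: W] == Pt]| = (q ^_ #|Pt|)%N.
Proof.
move=> pPt; have /and3P [/eqP cPt tPt nPt] := pPt.
have bl w : pblock Pt w \in Pt by rewrite pblock_mem // cPt inE.
pose b w : {B | B \in Pt} := exist (fun B => is_true (B \in Pt)) _ (bl w).
have bsurj (B : {B | B \in Pt}) : exists w, b w = B.
  case: B => B BPt; have [B0 | [w wB]] := set_0Vmem B; first by rewrite -B0 BPt in nPt.
  by exists w; apply: val_inj => /=; apply: def_pblock.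
pose h (g : {ffun {B | B \in Pt} -> 'I_q}) : {ffun W -> 'I_q} := [ffun w => g (b w)].
have cardPt : #|{: {B | B \in Pt}}| = #|Pt| by rewrite card_sig; apply: eq_card => B; rewrite inE.
transitivity (#|'I_q| ^_ #|{: {B | B \in Pt}}|)%N; last by rewrite card_ord cardPt.
rewrite -card_inj_ffuns -(card_imset (f := h)); last first.
  move=> g1 g2 eqg; apply/ffunP => B; have [w <-] := bsurj B.
  by have := congr1 (fun f : {ffun _} => f w) eqg; rewrite !ffunE.
apply: eq_card => f; rewrite inE; apply/(preim_partitionE _ pPt)/imsetP => [H | [g ginj ->] w z].
  have fP (B : {B | B \in Pt}) : exists i, [forall w, (b w == B) ==> (f w == i)].
    have [w <-] := bsurj B; exists (f w); apply/forallP => z; apply/implyP => /eqP /(congr1 val) /= bE.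
    by rewrite H bE.
  have [g gE] : exists g : {B | B \in Pt} -> 'I_q, forall w, g (b w) = f w.
    exists (fun B => xchoose (fP B)) => w.
    by have /forallP/(_ w)/implyP/(_ (eqxx _))/eqP := xchooseP (fP (b w)).
  exists (finfun g); last by apply/ffunP => w; rewrite !ffunE gE.
  rewrite inE; apply/injectiveP => B1 B2; have [w1 <-] := bsurj B1; have [w2 <-] := bsurj B2.
  rewrite !ffunE !gE => /eqP eqf; apply: val_inj; apply/eqP.
  by rewrite H in eqf.
rewrite !ffunE; move: ginj; rewrite inE => /injectiveP ginj.
by rewrite (inj_eq ginj) -val_eqE.
Qed.

Variable (e : rel W).
Hypothesis sym_e : connect_sym e.

Definition constant_along (T : eqType) (f : W -> T) :=
  [forall w, forall z, e w z ==> (f w == f z)].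

Lemma constant_alongP (T : eqType) (f : W -> T) :
  reflect (forall w z, connect e w z -> f w = f z) (constant_along f).
Proof.
apply: (iffP forallP) => [H w z | H w].
  case/connectP=> p pth ->; elim: p w pth => //= y p IHp w /andP [ewy /IHp <-].
  by have /forallP/(_ y)/implyP/(_ ewy)/eqP := H w.
by apply/forallP => z; apply/implyP => ewz; apply/eqP/H/connect1.
Qed.

(** Such a colouring is determined by arbitrary values at the roots of the components. The number of
    colours is a successor so that [ord0] can serve as default away from the roots. *)
Lemma card_constant_along q :
  #|[set f : {ffun W -> 'I_q.+1} | constant_along f]|
    = (q.+1 ^ #|[set w | fingraph.root e w == w]|)%N.
Proof.
set D := [set _ | _].
have rr w : fingraph.root e w \in D by rewrite inE (root_root sym_e).
transitivity #|pffun_on (ord0 : 'I_q.+1) [in D] predT|; last by rewrite card_pffun_on card_ord.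
pose h (g : {ffun W -> 'I_q.+1}) : {ffun W -> 'I_q.+1} := [ffun w => g (fingraph.root e w)].
rewrite -[RHS](card_in_imset (f := h)); last first.
  move=> g1 g2 g1P g2P eqg; have [s1 _] := pffun_onP g1P; have [s2 _] := pffun_onP g2P; apply/ffunP => w.
  have [wD | wD] := boolP (w \in D).
    have := congr1 (fun f : {ffun _} => f w) eqg; rewrite !ffunE.
    by move: wD; rewrite inE => /eqP ->.
  have zero (g : {ffun W -> 'I_q.+1}) : ord0.-support g \subset [in D] -> g w = ord0.
    by move=> /subsetP sg; apply/eqP; apply: contraR wD => gw; apply: sg.
  by rewrite !zero.
apply: eq_card => f; rewrite inE; apply/constant_alongP/imsetP => [H | [g _ ->] w z].
  exists [ffun w => if w \in D then f w else ord0].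
    apply/pffun_onP; split=> //; apply/subsetP => w; rewrite !inE ffunE inE.
    by case: ifP; rewrite // eqxx.
  apply/ffunP => w; rewrite !ffunE rr; apply: H; exact: connect_root.
by rewrite !ffunE => /(fingraph.rootP sym_e) ->.
Qed.

Definition closed_partition Pt := partition Pt [set: W] && constant_along (pblock Pt).

(** The colourings constant on components are sorted by their partition into colour classes. *)
Lemma sum_closed_partitions q :
  (\sum_(Pt | closed_partition Pt) q.+1 ^_ #|Pt| =
    q.+1 ^ #|[set w | fingraph.root e w == w]|)%N.
Proof.
rewrite -card_constant_along -sum1_card.
rewrite (partition_big (fun f : {ffun W -> 'I_q.+1} => preim_partition f [set: W])
  closed_partition) /=; last first.
  move=> f; rewrite inE => /constant_alongP cf; rewrite /closed_partition preim_partitionP /=.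
  apply/constant_alongP => w z /cf fwz; apply/eqP.
  by have /preim_partitionE <- := eqxx (preim_partition f [set: W]);
    rewrite ?fwz ?preim_partitionP.
apply: eq_bigr => Pt /andP [pPt /constant_alongP cPt].
rewrite -card_colourings_of_partition // -sum1_card; apply: eq_bigl => f.
rewrite !inE andbC; case: (preim_partitionE f pPt) => // H; rewrite andTb.
by apply/esym/constant_alongP => w z /cPt bwz; apply/eqP; rewrite H bwz.
Qed.

(* Both sides are polynomials in the number q of colours; evaluated at q = -2, the falling
   factorial of length l is (-1)^l (l+1)!. *)
Lemma sum_closed_partitions_fact (R : fieldType) : [pchar R] =i pred0 ->
  \sum_(Pt | closed_partition Pt) (-1) ^+ #|Pt| * ((#|Pt|.+1)`!)%:R
    = (-2) ^+ #|[set w | fingraph.root e w == w]| :> R.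
Proof.
move=> char0; have n0 := (pcharf0P R).1 char0; set K := #|_|.
pose ff l : {poly R} := \prod_(i < l) ('X - i%:R%:P).
pose p : {poly R} := 'X^K - \sum_(Pt | closed_partition Pt) ff #|Pt|.
have ffE l (q : nat) : (ff l).[q%:R] = (q ^_ l)%:R.
  rewrite /ff horner_prod; elim: l => [|l IHl]; first by rewrite big_ord0.
  rewrite big_ord_recr /= IHl !hornerE ffactnSr natrM.
  have [le | lt] := leqP l q; first by rewrite natrB.
  by rewrite ffact_small // mul0r mul0r.
(* [p] vanishes at 1, ..., [size p], which are distinct in characteristic zero and more numerous
   than its degree allows. *)
have p0 : p = 0.
  apply/eqP; apply: contraT => pn0.
  have rs : all (root p) [seq q.+1%:R | q <- iota 0 (size p)].
    apply/allP => _ /mapP [q _ ->]; rewrite rootE /p !hornerE horner_sum.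
    rewrite (eq_bigr (fun Pt : {set {set W}} => (q.+1 ^_ #|Pt|)%:R)) => [|Pt _]; last exact: ffE.
    by rewrite -natr_sum sum_closed_partitions natrX subrr.
  have us : uniq [seq (q.+1%:R : R) | q <- iota 0 (size p)].
    rewrite map_inj_uniq ?iota_uniq // => q1 q2 eqq; apply/eqP.
    wlog le : q1 q2 eqq / (q1 <= q2)%N.
      by move=> H; case/orP: (leq_total q1 q2) => le; [|rewrite eq_sym]; apply: H.
    move/eqP: eqq; rewrite eq_sym -subr_eq0 -natrB // n0 subSS subn_eq0 => le2.
    by rewrite eqn_leq le.
  by have := max_poly_roots pn0 rs us; rewrite size_map size_iota ltnn.
have := congr1 (fun p : {poly R} => p.[-2]) p0; rewrite /p !hornerE horner_sum.
move/eqP; rewrite subr_eq0 => /eqP ->; apply: eq_bigr => Pt _; rewrite /ff horner_prod.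
elim: #|Pt| => [|l IHl]; first by rewrite big_ord0 expr0 mul1r.
rewrite big_ord_recr /= -IHl !hornerE exprS factS natrM.
have -> : -2 - l%:R = - l.+2%:R :> R by rewrite -opprD -natrD.
by rewrite mulN1r !mulNr mulrN -mulrA [_%:R * l.+2%:R]mulrC.
Qed.

End Colourings.

(** * Matchings and chord diagrams *)

Section Matchings.
Variable n : nat.
Local Notation W := 'I_(n.*2).
Implicit Types (M : W -> W) (m c : {ffun W -> W}) (U : {set W}).

(** All components are counted, whereas [c2] leaves out those with a free vertex. *)
Definition ncomp M c := #|[set w | fingraph.root (chordrel M c) w == w]|.

Definition splits (f : W -> W) U := [forall w, (w \in U) != (f w \in U)].

Definition is_matching m := [forall w, (m (m w) == w) && (m w != w)].

Lemma matchingP m : reflect (forall w, m (m w) = w /\ m w != w) (is_matching m).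
Proof.
apply: (iffP forallP) => H w; first by have /andP [/eqP] := H w.
by have [-> ->] := H w; rewrite eqxx.
Qed.

Lemma splitsP f U : reflect (forall w, (f w \in U) = (w \notin U)) (splits f U).
Proof.
by apply: (iffP forallP) => H w; have := H w; [|move->]; case: (w \in U); case: (f w \in U).
Qed.

Section TwoMatchings.
Variables (M : W -> W) (c : {ffun W -> W}).
Hypotheses (MM : forall w, M (M w) = w) (cc : forall w, c (c w) = w).
Local Notation e := (chordrel M c).

Lemma chordrel_connect : connect_sym e.
Proof.
apply: sym_connect_sym => w z; rewrite /chordrel; congr (_ || _).
  by apply/eqP/eqP => ->.
by apply/andP/andP => -[/eqP -> cz]; rewrite !cc eqxx eq_sym.
Qed.

Lemma chordrel_const (T : Type) (phi : W -> T) w z :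
    (forall w, phi (M w) = phi w) -> (forall w, phi (c w) = phi w) ->
  connect e w z -> phi w = phi z.
Proof.
move=> phiM phic /connectP [p pth ->]; elim: p w pth => //= y p IHp w /andP [ewy /IHp <-].
by case/orP: ewy => [/eqP -> | /andP [/eqP -> _]].
Qed.

Lemma connect_M w : connect e w (M w).
Proof. by apply: connect1; rewrite /chordrel eqxx. Qed.

Lemma connect_c w : connect e w (c w).
Proof.
have [-> | cw] := eqVneq (c w) w; first exact: connect0.
by apply: connect1; rewrite /chordrel eqxx cw orbT.
Qed.

Lemma root_M w : fingraph.root e (M w) = fingraph.root e w.
Proof. by apply/esym/(fingraph.rootP chordrel_connect)/connect_M. Qed.

Lemma root_c w : fingraph.root e (c w) = fingraph.root e w.
Proof. by apply/esym/(fingraph.rootP chordrel_connect)/connect_c. Qed.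

End TwoMatchings.

(** * Components of the union of two perfect matchings *)

Section Splittings.
Variables (M : W -> W) (m : {ffun W -> W}).
Hypotheses (MP : forall w, M (M w) = w /\ M w != w) (mP : forall w, m (m w) = w /\ m w != w).
Let MM w : M (M w) = w. Proof. by case: (MP w). Qed.
Let mm w : m (m w) = w. Proof. by case: (mP w). Qed.
Local Notation e := (chordrel M m).
Local Notation root := (fingraph.root e).
Let sym_e : connect_sym e := chordrel_connect MM mm.

Let tau w := m (M w).
Let tau_inj : injective tau.
Proof. by move=> w z /(congr1 m); rewrite !mm => /(congr1 M); rewrite !MM. Qed.

(** An equality for [j + 2] at [w] yields one for [j] at [tau w]; the descent ends at a fixed point
    of [M] or of [m]. *)
Let iter_tau j w : iter j tau w != M w.
Proof.
elim/ltn_ind: j w => -[|[|j]] IH w.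
- by rewrite eq_sym; case: (MP w).
- by case: (mP (M w)).
apply: contra (IH j (leqnSn _) (tau w)) => /eqP H; apply/eqP.
have step z : M (m (tau z)) = z by rewrite /tau mm MM.
by rewrite -iterSr -[LHS]step -iterS H.
Qed.

Let orb r w := fconnect tau r w.

Let orb_m r w : orb r (m w) = orb r (M w).
Proof. by rewrite /orb -{1}[w]MM -/(tau (M w)) -(same_fconnect1_r tau_inj). Qed.

(** The orbit of the root and its image under [M] cover the component, and [iter_tau] makes them
    disjoint. *)
Let orb_root_M w : orb (root w) (M w) = ~~ orb (root w) w.
Proof.
have cov : orb (root w) w || orb (root w) (M w).
  have : connect e (root w) w by rewrite sym_e connect_root.
  move=> /(@chordrel_const M m _ (fun z => orb (root w) z || orb (root w) (M z))) => <-.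
  - by rewrite /orb connect0.
  - by move=> z; rewrite MM orbC.
  - move=> z; rewrite orb_m orbC; congr (_ || _).
    by rewrite /orb (same_fconnect1_r tau_inj) /tau MM mm.
case: (boolP (orb _ w)) cov => [o1 _|_ /= ->] //.
apply/negP => o2; have : fconnect tau w (M w).
  by apply: connect_trans o2; rewrite fconnect_sym.
by move/iter_findex/eqP; rewrite (negbTE (iter_tau _ _)).
Qed.

(* Along a component the matchings M and m alternate, so each component is the disjoint union of
   an orbit of m o M and its image under M, and these are the only two ways to split it. *)
Lemma card_splits : #|[set U | splits M U && splits m U]| = (2 ^ ncomp M m)%N.
Proof.
rewrite -card_powerset; set D := [set _ | _ == _].
(* [S] records the components in which the orbit of the root is taken; in the others its complement
   is taken. *)
pose h (S : {set W}) := [set w | orb (root w) w == (root w \in S)].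
have rootD w : root w \in D by rewrite inE (root_root sym_e).
have hroot S r : r \in D -> (r \in h S) = (r \in S).
  by rewrite !inE => /eqP ->; rewrite /orb connect0; case: (r \in S).
rewrite -[RHS](card_in_imset (f := h)); last first.
  move=> S1 S2; rewrite !inE => /subsetP s1 /subsetP s2 eqh; apply/setP => r.
  have [rD | rD] := boolP (r \in D); first by rewrite -(hroot S1) // -(hroot S2) // eqh.
  by apply/idP/idP => [/s1 | /s2] rD'; rewrite rD' in rD.
apply: eq_card => U; rewrite inE; apply/andP/imsetP => [[/splitsP sM /splitsP sm] | [S _ ->]].
  exists (U :&: D); first by rewrite inE subsetIr.
  apply/setP => w; rewrite !inE (root_root sym_e) eqxx andbT.
  have : (w \in U) (+) orb (root w) w = (root w \in U) (+) orb (root (root w)) (root w).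
    apply: (@chordrel_const M m _ (fun z => (z \in U) (+) orb (root z) z)) (connect_root e w) => z.
      by rewrite sM root_M // orb_root_M addNb addbN negbK.
    by rewrite sm root_c // orb_m orb_root_M addNb addbN negbK.
  rewrite (root_root sym_e) [orb (root w) (root w)]connect0.
  by case: (w \in U); case: (root w \in U); case: (orb _ _).
split; apply/splitsP => w; rewrite !inE ?root_M ?root_c //.
  by rewrite orb_root_M; case: orb; case: (root w \in S).
by rewrite orb_m orb_root_M; case: orb; case: (root w \in S).
Qed.

(** Following [m] from [u k] to [v (p k)] and then [M] to [u (p k)] stays in one component, so the
    cycles of [p] correspond to the components; the parity of [p] is that of [n] minus their
    number. *)
Lemma odd_perm_matching (u v : 'I_n -> W) (p : 'S_n) :
    injective u -> (forall k k', u k != v k') -> (forall w, exists k, w = u k \/ w = v k) ->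
    (forall k, M (u k) = v k) -> (forall k, m (u k) = v (p k)) ->
  p = odd n (+) odd (ncomp M m) :> bool.
Proof.
move=> u_inj uv cov Mu mu.
have Mv k : M (v k) = u k by rewrite -Mu MM.
have mv k : m (v (p k)) = u k by rewrite -mu mm.
have v_inj : injective v by move=> k k' /(congr1 M); rewrite !Mv => /u_inj.
have cov' w : exists k, (w == u k) || (w == v k).
  by have [k [->|->]] := cov w; exists k; rewrite eqxx ?orbT.
pose kidx w := xchoose (cov' w).
have kidxE w : (w == u (kidx w)) || (w == v (kidx w)) := xchooseP (cov' w).
have kidxu k : kidx (u k) = k.
  have := kidxE (u k); rewrite (negbTE (uv _ _)) orbF => /eqP /u_inj; exact: esym.
have kidxv k : kidx (v k) = k.
  by have := kidxE (v k); rewrite eq_sym (negbTE (uv _ _)) => /eqP /v_inj.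
rewrite /odd_perm card_ord; congr (_ (+) odd _).
pose h w := porbit p (kidx w).
have hM w : h (M w) = h w.
  by have [k [->|->]] := cov w; rewrite ?Mu ?Mv /h kidxu kidxv.
have porb k : porbit p (p k) = porbit p k by have := porbit_perm p 1 k; rewrite expg1.
have hm w : h (m w) = h w.
  have [k [->|->]] := cov w; first by rewrite mu /h kidxu kidxv porb.
  by rewrite -[k](permKV p) mv /h kidxu kidxv porb.
rewrite /ncomp -[RHS](card_in_imset (f := h)); last first.
  have conu w : connect e w (u (kidx w)).
    by have /orP[/eqP {1}-> | /eqP {1}->] := kidxE w; rewrite ?connect0 // -Mv connect_M.
  have conp k : connect e (u k) (u (p k)).
    by apply: connect_trans (connect_c M m (u k)) _; rewrite mu -(Mv (p k)) connect_M.
  move=> w1 w2; rewrite !inE => /eqP r1 /eqP r2 /eqP; rewrite /h eq_porbit_mem.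
  case/porbitP=> i kE; rewrite -r1 -r2; apply/(fingraph.rootP sym_e).
  apply: connect_trans (conu w1) _; rewrite sym_e.
  apply: connect_trans (conu w2) _; rewrite sym_e kE.
  elim: i {kE} => [|i IHi]; first by rewrite expg0 perm1.
  by rewrite expgSr permM; apply: connect_trans IHi; rewrite sym_e.
apply: eq_card => X; apply/imsetP/imsetP => [[k _ ->] | [w _ ->]].
  exists (root (u k)); first by rewrite inE (root_root sym_e).
  by rewrite -(chordrel_const hM hm (connect_root e (u k))) /h kidxu.
by exists (kidx w).
Qed.

End Splittings.

(** * Opening one chord of a perfect matching *)

Section Cut.

Lemma even_closed (g : W -> W) (A : {set W}) :
  (forall w, w \in A -> [/\ g w \in A, g (g w) = w & g w != w]) -> ~~ odd #|A|.
Proof.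
move=> gA; rewrite -(cardsID [set w : W | (w < g w)%N] A).
suff -> : #|A :\: [set w : W | (w < g w)%N]| = #|A :&: [set w : W | (w < g w)%N]| by rewrite addnn odd_double.
rewrite -[RHS](card_in_imset (f := g)); last first.
  move=> w z /setIP [/gA [_ gw _] _] /setIP [/gA [_ gz _] _] /(congr1 g).
  by rewrite gw gz.
apply: eq_card => w; apply/setDP/imsetP => [[wA] | [z /setIP [zA]]]; rewrite inE.
  have [gwA gw ne] := gA _ wA; rewrite -leqNgt => le; exists (g w) => //.
  by rewrite !inE gwA gw ltn_neqAle le andbT.
by move=> zlt ->; have [gzA gz _] := gA _ zA; rewrite inE gz -leqNgt ltnW.
Qed.

(** The chord at [w0] is removed; its two ends become fixed points, the encoding of free vertices in
    [isD1]. *)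
Definition cut m (w0 : W) : {ffun W -> W} :=
  [ffun w => if (w == w0) || (w == m w0) then w else m w].

Variables (M : W -> W) (m : {ffun W -> W}).
Hypotheses (MP : forall w, M (M w) = w /\ M w != w) (mP : forall w, m (m w) = w /\ m w != w).
Let MM w : M (M w) = w. Proof. by case: (MP w). Qed.
Let mm w : m (m w) = w. Proof. by case: (mP w). Qed.
Variable w0 : W.

Lemma cutE w : cut m w0 w = if (w == w0) || (w == m w0) then w else m w.
Proof. by rewrite ffunE. Qed.

Lemma cut_fix w : (cut m w0 w == w) = (w == w0) || (w == m w0).
Proof. by rewrite cutE; case: ifP; rewrite ?eqxx //; case: (mP w) => _ /negbTE. Qed.

Lemma cut_involutive w : cut m w0 (cut m w0 w) = w.
Proof.
rewrite [cut m w0 w]cutE; case: ifPn => H; first by rewrite cutE H.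
rewrite cutE mm (can_eq mm) ifN //; apply: contra H.
by rewrite orbC => /orP [->|/eqP <-] //; rewrite mm eqxx orbT.
Qed.

Lemma cut_isD1 : isD1 (cut m w0).
Proof.
apply/andP; split; first by apply/forallP => w; rewrite cut_involutive.
rewrite (_ : [set _ | _] = [set w0; m w0]); last by apply/setP => w; rewrite !inE cut_fix.
by rewrite cards2 (eq_sym w0); case: (mP w0) => _ ->.
Qed.

Let symc : connect_sym (chordrel M (cut m w0)) := chordrel_connect MM cut_involutive.

(* By parity a component cannot contain exactly one free vertex. *)
Lemma cut_connect_free : connect (chordrel M (cut m w0)) w0 (m w0).
Proof.
set e := chordrel M _; pose A := [set z | connect e w0 z].
have AM : ~~ odd #|A|.
  apply: (even_closed (g := M)) => w; rewrite !inE => wA; case: (MP w) => _ Mw; split=> //.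
  exact: connect_trans wA (connect_M _ _ _).
apply: contraR AM => nA; rewrite (cardsD1 w0) inE connect0 /=.
apply: (even_closed (g := m)) => w; rewrite !inE => /andP [ww0 wA].
have [_ mw] := mP w; split=> //; apply/andP; split.
  by apply: contra nA => /eqP mw0; rewrite -{2}mw0 mm.
have wm0 : w != m w0 by apply: contraNneq nA => <-.
have := connect_c M (cut m w0) w; rewrite cutE (negbTE ww0) (negbTE wm0) /=.
exact: connect_trans.
Qed.

Lemma connect_cut : connect (chordrel M m) =2 connect (chordrel M (cut m w0)).
Proof.
move=> w z; apply/idP/idP; apply: connect_sub => {}w {}z /orP [/eqP -> | /andP [/eqP -> wz]].
- exact: connect_M.
- have := connect_c M (cut m w0) w; rewrite cutE; case: ifP => // /orP [] /eqP ->.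
    by rewrite cut_connect_free.
  by rewrite mm symc cut_connect_free.
- exact: connect_M.
- rewrite cutE; case: ifP => // _; exact: connect_c.
Qed.

(** Opening the chord keeps the components, but the one of [w0] becomes a path between the free
    vertices and is no longer counted by [c2]. *)
Lemma ncomp_cut : ncomp M m = (c2 M (cut m w0)).+1.
Proof.
set c := cut m w0; have eqr : fingraph.root (chordrel M m) =1 fingraph.root (chordrel M c).
  by move=> w; rewrite /fingraph.root (eq_pick (connect_cut w)).
set r := fingraph.root (chordrel M c) in eqr.
rewrite /ncomp /c2 -(cardsID [set w | [forall z, connect (chordrel M c) w z ==> (c z != z)]]).
rewrite -[RHS]addn1; congr (_ + _)%N.
  by apply: eq_card => w; rewrite !inE eqr.
rewrite (_ : _ :\: _ = [set r w0]) ?cards1 //; apply/setP => w; rewrite !inE eqr negb_forall.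
apply/andP/eqP => [[/existsP [z]] | ->].
  rewrite negb_imply negbK cut_fix => /andP [wz zf] /eqP <-.
  apply/(fingraph.rootP symc); apply: connect_trans wz _; rewrite symc.
  by case/orP: zf => /eqP ->; rewrite ?connect0 // cut_connect_free.
split; last exact/eqP/(root_root symc).
apply/existsP; exists w0; rewrite negb_imply negbK cut_fix eqxx andbT.
by rewrite symc connect_root.
Qed.

End Cut.

(** A diagram closes up uniquely by joining its two free vertices; taking [w0] as the smaller one
    counts each diagram once. *)
Lemma sum_isD1 (A : nmodType) (F : {ffun W -> W} -> A) :
  \sum_(c | isD1 c) F c = \sum_(m | is_matching m) \sum_(w0 : W | (w0 < m w0)%N) F (cut m w0).
Proof.
rewrite pair_big_dep /=.
rewrite [RHS](partition_big (fun p => cut p.1 p.2) (@isD1 n)) /=; last first.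
  by move=> [m w0] /= /andP [/matchingP mP _]; apply: cut_isD1.
apply: eq_bigr => c /andP [/forallP cc cards2c]; have [a' [b' [ab' cfix']]] := cards2P _ cards2c.
have {}cc w : c (c w) = w by apply/eqP.
have [a [b [ab cfix]]] : exists a b : W, (a < b)%N /\ forall w, (c w == w) = (w == a) || (w == b).
  have H w : (c w == w) = (w == a') || (w == b').
    by have /setP/(_ w) := cfix'; rewrite !inE.
  case: (ltngtP a' b') => [lt | lt | /val_inj eq]; last by rewrite eq eqxx in ab'.
    by exists a', b'.
  by exists b', a'; split=> // w; rewrite orbC.
have ab0 : (b == a) = false by apply/negbTE; rewrite -val_eqE /= neq_ltn ab orbT.
pose m := [ffun w => if w == a then b else if w == b then a else c w] : {ffun W -> W}.
have mP w : m (m w) = w /\ m w != w.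
  rewrite !ffunE; have [->|wa] := eqVneq w a; first by rewrite ab0 eqxx.
  have [->|wb] := eqVneq w b; first by rewrite eqxx eq_sym ab0.
  have cw : c w != w by rewrite cfix negb_or wa wb.
  have fx z : (c z == z) -> c w != z.
    by move=> /eqP cz; apply: contraNneq cw => cwz; rewrite -{2}[w]cc cwz cz.
  by rewrite !ifN ?cc // fx // cfix eqxx ?orbT.
have ma : m a = b by rewrite ffunE eqxx.
rewrite (big_pred1 (m, a)) /=.
  congr F; apply/ffunP => w; rewrite cutE ma -cfix ffunE.
  case: eqP => [//|/eqP]; rewrite cfix negb_or => /andP [/negbTE -> /negbTE ->] //.
move=> [m' w0]; rewrite /= -pair_eqE /=.
apply/andP/andP => [[/andP [/matchingP m'P lt] /eqP cE] | [/eqP -> /eqP ->]].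
  have fixE w : (w == w0) || (w == m' w0) = (w == a) || (w == b).
    by rewrite -cfix -cE cut_fix.
  have w0a : w0 = a.
    have := fixE w0; rewrite eqxx => /esym /orP [/eqP //|/eqP w0b].
    have := fixE a; rewrite eqxx => /orP [/eqP //|/eqP am].
    by move: lt; rewrite -am w0b ltnNge ltnW.
  have m'a : m' a = b.
    have := fixE b; rewrite eqxx orbT -w0a => /orP [/eqP bw0 | /eqP -> //].
    by move: ab0; rewrite bw0 w0a eqxx.
  split; apply/eqP => //; apply/ffunP => w; rewrite ffunE.
  have [->//|wa] := eqVneq w a; have [->|wb] := eqVneq w b.
    by rewrite -m'a; case: (m'P a).
  by rewrite -cE cutE fixE (negbTE wa) (negbTE wb).
split.
  by apply/andP; split; [apply/matchingP | rewrite ma].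
apply/eqP/ffunP => w; rewrite cutE ma -cfix ffunE.
by case: eqP => [//|/eqP]; rewrite cfix negb_or => /andP [/negbTE -> /negbTE ->].
Qed.

End Matchings.

(** * Determinants of words *)

Section Determinants.
Variable A : comNzRingType.

(** Indexing entries by [nat] avoids casts when the size is the length of a word. *)
Definition detn k (f : nat -> nat -> A) := \det (\matrix_(i < k, j < k) f i j).

Lemma eq_detn k f g : (forall i j, (i < k)%N -> (j < k)%N -> f i j = g i j) ->
  detn k f = detn k g.
Proof. by move=> fg; congr (\det _); apply/matrixP => i j; rewrite !mxE fg. Qed.

Lemma detn_block k1 k2 f :
    (forall i j, (k1 <= i < k1 + k2)%N -> (j < k1)%N -> f i j = 0) ->
  detn (k1 + k2) f = detn k1 f * detn k2 (fun i j => f (k1 + i)%N (k1 + j)%N).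
Proof.
move=> f0; rewrite /detn -[X in \det X]submxK.
rewrite (_ : dlsubmx _ = 0) ?det_ublock; last first.
  by apply/matrixP => i j; rewrite !mxE f0 //= leq_addr ltn_add2l ltn_ord.
by congr (_ * _); congr (\det _); apply/matrixP => i j; rewrite !mxE.
Qed.

(** Matching blocks of rows and columns have equal length, so the matrix is block diagonal. *)
Lemma detn_flatten (I : eqType) (T : Type) (x0 : T) (N : T -> T -> A) (r : seq I) (s t : I -> seq T) :
    uniq r -> (forall B, B \in r -> size (s B) = size (t B)) ->
    (forall B B' i j, B \in r -> B' \in r -> B != B' -> (i < size (s B))%N -> (j < size (t B'))%N ->
      N (nth x0 (s B) i) (nth x0 (t B') j) = 0) ->
  detn (size (flatten [seq s B | B <- r]))
    (fun i j => N (nth x0 (flatten [seq s B | B <- r]) i) (nth x0 (flatten [seq t B | B <- r]) j))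
  = \prod_(B <- r) detn (size (s B)) (fun i j => N (nth x0 (s B) i) (nth x0 (t B) j)).
Proof.
elim: r => [|B r IHr] /=; first by move=> *; rewrite big_nil /detn det_mx00.
case/andP=> Br ur st N0; rewrite big_cons -IHr //; first last.
- by move=> B1 B2 i j h1 h2; apply: N0; rewrite inE ?h1 ?h2 orbT.
- by move=> B1 h; apply: st; rewrite inE h orbT.
have sB : size (s B) = size (t B) by rewrite st // inE eqxx.
rewrite size_cat detn_block.
  congr (_ * _); apply: eq_detn => i j hi hj; rewrite !nth_cat -?sB ?hi ?hj //.
  by rewrite !ltnNge !leq_addr /= !addKn.
move=> i j /andP [le1 lt1] lt2; rewrite !nth_cat ltnNge le1 /= -sB lt2.
rewrite -(subnKC le1) ltn_add2l in lt1.
have aux r' i' : B \notin r' -> {subset r' <= B :: r} ->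
    (i' < size (flatten [seq s B | B <- r']))%N ->
    N (nth x0 (flatten [seq s B | B <- r']) i') (nth x0 (t B) j) = 0.
  elim: r' i' => //= B' r' IHr' i'; rewrite inE negb_or => /andP [BB' Br'] sub.
  have sB' : B' \in B :: r by apply: sub; rewrite inE eqxx.
  rewrite size_cat nth_cat => lti; have [lti' | lei] := ltnP i' (size (s B')).
    by apply: N0; rewrite ?mem_head -?sB // eq_sym.
  apply: IHr' => //; last by rewrite -(ltn_add2l (size (s B'))) subnKC.
  by move=> B1 h; apply: sub; rewrite inE h orbT.
by apply: aux => // B' h; rewrite inE h orbT.
Qed.

Lemma det_perms k (s t : 'S_k) (M : 'M[A]_k) :
  \det (\matrix_(i, j) M (s i) (t j)) = (-1) ^+ s * (-1) ^+ t * \det M.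
Proof.
have -> : \matrix_(i, j) M (s i) (t j) = row_perm s (col_perm t M).
  by apply/matrixP => i j; rewrite !mxE.
by rewrite row_permE col_permE !det_mulmx !det_perm odd_permV -mulrA (mulrC (\det M)).
Qed.

End Determinants.

(** * Sorting the letters of a word by the blocks of a partition *)

Section Words.
Variable n : nat.
Local Notation W := 'I_(n.*2).
Implicit Types (Pt : {set {set W}}) (f u v : 'I_n -> W).

Definition letters f (B : {set W}) := [seq k <- enum 'I_n | f k \in B].

(** The positions in the order in which their letters occur in the concatenation of the subwords. *)
Definition sorted_letters Pt f := flatten [seq letters f B | B <- enum Pt].

Variables (Pt : {set {set W}}) (f : 'I_n -> W).
Hypothesis pPt : partition Pt [set: W].

Let tPt : trivIset Pt. Proof. by case/and3P: pPt. Qed.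
Let cPt w : w \in cover Pt. Proof. by case/and3P: pPt => /eqP ->; rewrite inE. Qed.

Lemma mem_letters B k : B \in Pt -> (k \in letters f B) = (pblock Pt (f k) == B).
Proof.
move=> BPt; rewrite mem_filter mem_enum andbT; apply/idP/eqP => [kB | <-].
  exact: def_pblock.
by rewrite mem_pblock.
Qed.

Definition letter_lt (k k' : 'I_n) : bool :=
  (bidx Pt (f k) < bidx Pt (f k'))%N || ((bidx Pt (f k) == bidx Pt (f k')) && (k < k')%N).

Lemma sorted_lettersP : pairwise letter_lt (sorted_letters Pt f).
Proof.
have pe : pairwise (fun B B' => index B (enum Pt) < index B' (enum Pt))%N (enum Pt).
  apply/(pairwiseP set0) => i j; rewrite !inE => hi hj lt.
  by rewrite !index_uniq ?enum_uniq.
have subPt : {subset enum Pt <= Pt} by move=> B; rewrite mem_enum.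
suff gen r : pairwise (fun B B' => index B (enum Pt) < index B' (enum Pt))%N r ->
    {subset r <= Pt} -> pairwise letter_lt (flatten [seq letters f B | B <- r]) by exact: gen.
elim: r => //= B r IHr /andP [Br pr] sub.
have BPt : B \in Pt by apply: sub; rewrite inE eqxx.
have sub' : {subset r <= Pt} by move=> B' h; apply: sub; rewrite inE h orbT.
rewrite pairwise_cat IHr // andbT; apply/andP; split.
  apply/allrelP => k k'; rewrite mem_letters // => /eqP kB /flattenP [s /mapP [B' B'r ->]].
  rewrite mem_letters ?sub' // => /eqP k'B'.
  by rewrite /letter_lt /bidx kB k'B' (allP Br).
have : {subset letters f B <= [pred k | pblock Pt (f k) == B]}.
  by move=> k; rewrite mem_letters.
have : pairwise (fun k k' : 'I_n => k < k')%N (letters f B).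
  apply: (subseq_pairwise (filter_subseq _ _)).
  rewrite -(pairwise_map val ltn) val_enum_ord.
  by rewrite -sorted_pairwise ?iota_ltn_sorted //; apply: ltn_trans.
elim: (letters f B) => //= k s IHs /andP [ks ps] sB; rewrite IHs // ?andbT; last first.
  by move=> k' h; apply: sB; rewrite inE h orbT.
apply/allP => k' k's; rewrite /letter_lt /bidx.
have /eqP -> : pblock Pt (f k) == B by apply: sB; rewrite inE eqxx.
have /eqP -> : pblock Pt (f k') == B by apply: sB; rewrite inE k's orbT.
by rewrite eqxx (allP ks) ?orbT.
Qed.

Lemma letter_lt_irr : irreflexive letter_lt.
Proof. by move=> k; rewrite /letter_lt !ltnn andbF. Qed.

Lemma letter_lt_asym k k' : letter_lt k k' -> letter_lt k' k = false.
Proof.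
rewrite /letter_lt; case: ltngtP => //= _ lt.
by rewrite ltnNge ltnW.
Qed.

Lemma perm_sorted_letters : perm_eq (sorted_letters Pt f) (enum 'I_n).
Proof.
apply: uniq_perm; rewrite ?enum_uniq //.
  have := sorted_lettersP; elim: sorted_letters => //= k s IHs /andP [ks /IHs ->].
  by rewrite andbT; apply/negP => /(allP ks); rewrite letter_lt_irr.
move=> k; rewrite mem_enum; apply/flattenP.
exists (letters f (pblock Pt (f k))); first by apply: map_f; rewrite mem_enum pblock_mem.
by rewrite mem_letters ?pblock_mem.
Qed.

Lemma size_sorted_letters : size (sorted_letters Pt f) = n.
Proof. by rewrite (perm_size perm_sorted_letters) size_enum_ord. Qed.

Lemma mem_sorted_letters k : k \in sorted_letters Pt f.
Proof. by rewrite (perm_mem perm_sorted_letters) mem_enum. Qed.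

(** In a strictly sorted list the index of an element is the number of elements below it. *)
Lemma index_sorted_letters k : index k (sorted_letters Pt f) = newpos Pt f k.
Proof.
transitivity (count (letter_lt^~ k) (sorted_letters Pt f)); last first.
  rewrite (seq.permP perm_sorted_letters) /newpos -sum1_count -sum1_card big_enum_cond /=.
  by apply: eq_bigl => k'; rewrite inE.
have := mem_sorted_letters k; have := sorted_lettersP.
elim: sorted_letters => //= k' s IHs /andP [k's ps]; rewrite inE.
have [-> _ | ne /= ks] := eqVneq k k'.
  rewrite letter_lt_irr; apply/esym/eqP; rewrite -leqn0 leqNgt -has_count.
  by apply/hasPn => k2 /(allP k's) /letter_lt_asym ->.
by rewrite (allP k's) // IHs.
Qed.

Lemma newpos_lt k : (newpos Pt f k < n)%N.
Proof. by rewrite -index_sorted_letters -{2}size_sorted_letters index_mem mem_sorted_letters. Qed.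

Lemma newpos_inj : injective (fun k => Ordinal (newpos_lt k)).
Proof.
move=> k k' /(congr1 val); rewrite /= -!index_sorted_letters => eqi.
by rewrite -(nth_index k (mem_sorted_letters k)) eqi nth_index ?mem_sorted_letters.
Qed.

Definition newperm : 'S_n := perm newpos_inj.

Lemma nth_newperm k0 k : nth k0 (sorted_letters Pt f) (newperm k) = k.
Proof. by rewrite permE /= -index_sorted_letters nth_index ?mem_sorted_letters. Qed.

(** Exactly one permutation realises [newpos], so the sum in [psign] has a single term. *)
Lemma psignE (A : nzRingType) : psign A Pt f = (-1) ^+ newperm.
Proof.
rewrite /psign (big_pred1 newperm) // => s; apply/forallP/eqP => [H | -> k].
  by apply/permP => k; apply: val_inj; rewrite permE; apply/eqP/H.
by rewrite permE.
Qed.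

End Words.

(** * Products of block determinants as sums over permutations respecting the blocks *)

Section BlockDeterminant.
Variables (n : nat) (A : comNzRingType).
Local Notation W := 'I_(n.*2).
Variables (Y : W -> W -> A) (Pt : {set {set W}}) (u v : 'I_n -> W) (w0 : W).
Hypothesis pPt : partition Pt [set: W].

Definition word (f : 'I_n -> W) (B : {set W}) := [seq f k | k <- enum 'I_n & f k \in B].

Definition det_words (B : {set W}) :=
  detn (size (word u B)) (fun i j => Y (nth w0 (word u B) i) (nth w0 (word v B) j)).

Lemma size_word f B : size (word f B) = #|[set k | f k \in B]|.
Proof.
rewrite size_map size_filter -sum1_count -sum1_card big_enum_cond /=.
by apply: eq_bigl => k; rewrite inE.
Qed.

(** Both sides are the determinant of [Y] with the entries between different blocks set to zero. Its
    Leibniz expansion is the right side; sorting rows and columns by blocks makes it block diagonal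
    and costs the two signs. *)
Lemma block_det : (forall B, B \in Pt -> size (word u B) = size (word v B)) ->
  psign A Pt u * psign A Pt v * \prod_(B in Pt) det_words B =
  \sum_(p : 'S_n | [forall k, pblock Pt (u k) == pblock Pt (v (p k))])
     (-1) ^+ p * \prod_k Y (u k) (v (p k)).
Proof.
move=> bal; rewrite !(psignE _ pPt).
pose N k k' := if pblock Pt (u k) == pblock Pt (v k') then Y (u k) (v k') else 0.
transitivity (\det (\matrix_(k, k') N k k')); last first.
  rewrite /determinant [RHS]big_mkcond; apply: eq_bigr => p _.
  case: ifPn => [/forallP H | /forallPn [k nk]].
    by congr (_ * _); apply: eq_bigr => k _; rewrite mxE /N H.
  by rewrite (bigD1 k) //= mxE /N (negbTE nk) mul0r mulr0.
have n_gt0 : (0 < n)%N by rewrite -double_gt0 (leq_ltn_trans _ (ltn_ord w0)).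
pose k0 := Ordinal n_gt0.
pose S := \matrix_(i < n, j < n) N (nth k0 (sorted_letters Pt u) i) (nth k0 (sorted_letters Pt v) j).
have -> : \matrix_(k, k') N k k' = \matrix_(i, j) S (newperm u pPt i) (newperm v pPt j).
  by apply/matrixP => i j; rewrite !mxE !nth_newperm.
rewrite det_perms; congr (_ * _).
have size_l f B : size (word f B) = size (letters f B) by rewrite size_map.
have nth_l f B i : (i < size (letters f B))%N -> nth w0 (word f B) i = f (nth k0 (letters f B) i).
  exact: nth_map.
have lB f B i : B \in Pt -> (i < size (letters f B))%N -> pblock Pt (f (nth k0 (letters f B) i)) = B.
  by move=> BPt lti; apply/eqP; rewrite -mem_letters // mem_nth.
have -> : \det S = detn (size (sorted_letters Pt u))
    (fun i j => N (nth k0 (sorted_letters Pt u) i) (nth k0 (sorted_letters Pt v) j)).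
  by rewrite size_sorted_letters.
rewrite detn_flatten ?enum_uniq //.
- rewrite -big_enum /=; apply: eq_big_seq => B; rewrite mem_enum => BPt.
  rewrite /det_words size_l; apply: eq_detn => i j lti ltj.
  have ltj' : (j < size (letters v B))%N by rewrite -size_l -bal ?size_l.
  by rewrite /N !lB // eqxx !nth_l.
- by move=> B; rewrite mem_enum => /bal; rewrite !size_l.
- move=> B B' i j; rewrite !mem_enum => BPt B'Pt ne lti ltj.
  by rewrite /N !lB // (negbTE ne).
Qed.

End BlockDeterminant.

(** Bordering by a corner 1 expresses the perturbed determinant as a Schur complement; linearity in
    the first row then makes it affine in [t]. *)
Lemma det_rank1 (A : comNzRingType) k (M : 'M[A]_k) (p : 'cV_k) (q : 'rV_k) t :
  \det (M + t *: (p *m q)) = \det M + t * \det (block_mx (0 : 'M_1) (- q) p M).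
Proof.
pose B := block_mx (1%:M : 'M_1) (- (t *: q)) p M.
have -> : \det (M + t *: (p *m q)) = \det B.
  have := det_mulmx B (block_mx (1%:M : 'M_1) (t *: q) 0 1%:M).
  rewrite mulmx_block !mul1mx !mulmx1 !mulmx0 !addr0 subrr det_lblock det_ublock !det1.
  by rewrite !mul1r mulr1 -scalemxAr addrC.
rewrite -[\det M in RHS]mul1r -[X in X * \det M](det1 A 1) -(det_lblock _ p) -[X in _ = X + _]mul1r.
have sl (i : 'I_1) : split (lshift k i) = inl i := unsplitK (inl i).
have sr (i : 'I_k) : split (rshift 1 i) = inr i := unsplitK (inr i).
have low (D D' : 'M[A]_1) (E E' : 'rV[A]_k) :
    row' (lshift k 0) (block_mx D E p M) = row' (lshift k 0) (block_mx D' E' p M).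
  apply/matrixP => i j; rewrite !mxE; case: splitP => // i1 /=.
  by rewrite (ord1 i1).
apply: (determinant_multilinear (i0 := lshift k 0)); [|exact: low|exact: low].
by apply/rowP => j; case: (split_ordP j) => j' ->; rewrite !mxE sl !mxE ?sl ?sr ?mxE; ring.
Qed.

Lemma coef1M (A : nzSemiRingType) (p q : {poly A}) : (p * q)`_1 = p`_0 * q`_1 + p`_1 * q`_0.
Proof. by rewrite coefM !big_ord_recl big_ord0 addr0. Qed.

Lemma coef1_prod (A : comNzSemiRingType) (I : finType) (P : {set I}) (D : I -> {poly A}) :
  (\prod_(i in P) D i)`_1 = \sum_(i in P) (D i)`_1 * \prod_(j in P | j != i) (D j)`_0.
Proof.
rewrite -big_enum -[RHS]big_enum /=.
under [RHS]eq_bigr do rewrite -big_enum_cond /=.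
elim: (enum P) (enum_uniq P) => [|i r IHr] /=; first by rewrite !big_nil coef1.
case/andP=> ir ur; rewrite !big_cons coef1M IHr // eqxx /=.
rewrite [LHS]addrC; congr (_ + _); first congr (_ * _).
  rewrite coef0_prod big_seq_cond [RHS]big_seq_cond; apply: eq_bigl => j.
  by rewrite andbT; case: (boolP (j \in r)) => //= jr; apply/esym; apply: contraNneq ir => <-.
rewrite mulr_sumr big_seq [RHS]big_seq; apply: eq_bigr => j jr.
rewrite big_cons ifT; first by rewrite mulrCA.
by apply: contraNneq ir => ->.
Qed.

(** * Dodgson polynomials as coefficients of a perturbed determinant *)

Section DodgsonWords.
Variables (R : fieldType) (V E : finType) (Gam Gbul : graph V E) (alpha : E -> R).
Variables (T : Type) (w0 : T) (lab : T -> E) (xi : T -> R).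
Local Notation K := (Kirchhoff Gam alpha).
Local Notation Kb := (Kirchhoff Gbul alpha).
Hypotheses (K0 : K != 0) (Kb0 : Kb != 0).
Local Notation X w w' := (cyclepoly Gam alpha (lab w) (lab w')).
Hypothesis XbE : forall w w', cyclepoly Gbul alpha (lab w) (lab w') =
  Kb / K * X w w' + K^-1 * (xi w * xi w').

(** The value at 0 is [X w w' / K]; by [XbE] the value at [Kb^-1] is the cycle polynomial of [Gbul]
    divided by [Kb]. *)
Definition edge_weight w w' : {poly R} := (X w w' / K)%:P + 'X * (xi w * xi w' / K)%:P.

Lemma dodgson_detn (G : graph V E) us vs : (0 < size us)%N -> size us = size vs ->
  dodgson G alpha (map lab us) (map lab vs) = Kirchhoff G alpha ^- (size us).-1 *
    detn (size us) (fun i j => cyclepoly G alpha (lab (nth w0 us i)) (lab (nth w0 vs j))).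
Proof.
case: us => // w us _ sz.
transitivity (Kirchhoff G alpha ^- (size (map lab (w :: us))).-1 *
  detn (size (map lab (w :: us))) (fun i j => cyclepoly G alpha
    (nth (lab w) (map lab (w :: us)) i) (nth (lab w) (map lab vs) j))); first by [].
rewrite size_map; congr (_ * _).
congr (\det _); apply/matrixP => i j; rewrite !mxE !(nth_map w0) // -sz; exact: ltn_ord.
Qed.

(** By [det_rank1] the determinant is affine. Scalar values of [t] are included so that the
    coefficients can be compared at 0 and at [Kb^-1]. *)
Lemma detn_edge_weight us vs : exists c0 c1,
  detn (size us) (fun i j => edge_weight (nth w0 us i) (nth w0 vs j)) = c0%:P + 'X * c1%:P
  /\ forall t, detn (size us) (fun i j => X (nth w0 us i) (nth w0 vs j) / K
       + t * (xi (nth w0 us i) * xi (nth w0 vs j) / K)) = c0 + t * c1.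
Proof.
set k := size us.
pose M := \matrix_(i < k, j < k) (X (nth w0 us i) (nth w0 vs j) / K).
pose p := \col_(i < k) xi (nth w0 us i).
pose q := \row_(j < k) (xi (nth w0 vs j) / K).
pose C := block_mx (0 : 'M_1) (- q) p M.
exists (\det M), (\det C); split=> [|t]; rewrite /detn.
  have -> : \matrix_(i < k, j < k) edge_weight (nth w0 us i) (nth w0 vs j) =
      map_mx polyC M + 'X *: (map_mx polyC p *m map_mx polyC q).
    by apply/matrixP => i j; rewrite !mxE big_ord1 !mxE /edge_weight -polyCM mulrA.
  rewrite det_rank1 det_map_mx; congr (_ + _ * _).
  by rewrite -det_map_mx map_block_mx map_mx0 map_mxN.
rewrite -det_rank1; congr (\det _); apply/matrixP => i j.
by rewrite !mxE big_ord1 !mxE; congr (_ + t * _); rewrite mulrA.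
Qed.

Lemma detnZ k c (f : nat -> nat -> R) : detn k (fun i j => c * f i j) = c ^+ k * detn k f.
Proof. by rewrite /detn -detZ; congr (\det _); apply/matrixP => i j; rewrite !mxE. Qed.

Lemma dodgson_coef0 us vs : (0 < size us)%N -> size us = size vs ->
  dodgson Gam alpha (map lab us) (map lab vs) =
  K * (detn (size us) (fun i j => edge_weight (nth w0 us i) (nth w0 vs j)))`_0.
Proof.
move=> us0 sz; have [c0 [c1 [-> ct]]] := detn_edge_weight us vs.
rewrite coefD coefC coefXM addr0 /= dodgson_detn //.
have ct0 := ct 0; rewrite mul0r addr0 in ct0; rewrite -ct0.
rewrite (@eq_detn _ _ _ (fun i j => K * (X (nth w0 us i) (nth w0 vs j) / K
    + 0 * (xi (nth w0 us i) * xi (nth w0 vs j) / K)))); last first.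
  by move=> i j _ _; rewrite mul0r addr0 mulrCA mulfV ?mulr1.
rewrite detnZ; case: (size us) us0 => // k _.
by rewrite exprS /= -!mulrA mulrCA mulKf // expf_neq0.
Qed.

(** Evaluation at [Kb^-1] gives [Kb * (c0 + c1 / Kb)] for [Gbul]; the subtracted term is
    [Kb * c0]. *)
Lemma dodgson_coef1 us vs : (0 < size us)%N -> size us = size vs ->
  dodgson Gbul alpha (map lab us) (map lab vs)
    - Kb / K * dodgson Gam alpha (map lab us) (map lab vs) =
  (detn (size us) (fun i j => edge_weight (nth w0 us i) (nth w0 vs j)))`_1.
Proof.
move=> us0 sz; rewrite dodgson_coef0 // (dodgson_detn Gbul) //.
have [c0 [c1 [-> ct]]] := detn_edge_weight us vs.
rewrite !coefD !coefC !coefXM !coefC addr0 add0r /=.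
rewrite (@eq_detn _ _ _ (fun i j => Kb * (X (nth w0 us i) (nth w0 vs j) / K
    + Kb^-1 * (xi (nth w0 us i) * xi (nth w0 vs j) / K)))); last first.
  by move=> i j _ _; rewrite XbE; field; rewrite K0 Kb0.
rewrite detnZ ct; case: (size us) us0 => // k _ /=; rewrite exprS.
have : Kb ^+ k != 0 by rewrite expf_neq0.
by move: (Kb ^+ k) => b b0; field; rewrite K0 Kb0.
Qed.

End DodgsonWords.

(** * Pairs of complementary vertex sets, and matchings as permutations of letters *)

Section WordMatchings.
Variables (n : nat) (M2 : 'I_(n.*2) -> 'I_(n.*2)) (a : 'I_n -> 'I_(n.*2)).
Local Notation W := 'I_(n.*2).
Hypothesis n_gt0 : (0 < n)%N.
Hypotheses (MP : forall w, M2 (M2 w) = w /\ M2 w != w).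
Hypothesis aP : forall w, exists! k, w = a k \/ w = M2 (a k).
Let MM w : M2 (M2 w) = w. Proof. by case: (MP w). Qed.

Lemma splits_compl (f : W -> W) U : splits f (~: U) = splits f U.
Proof.
by apply: eq_forallb => w; rewrite !inE; case: (w \in U); case: (f w \in U).
Qed.

Lemma card_split U : splits M2 U -> #|U| = n.
Proof.
move/splitsP=> sU; apply: double_inj; rewrite -addnn -[RHS](card_ord n.*2) -(cardsC U).
congr (_ + _)%N; rewrite -(card_imset _ (can_inj MM)); apply: eq_card => w.
by rewrite -{1}[w]MM (mem_imset _ _ (can_inj MM)) sU inE.
Qed.

Lemma isP2P (P : {set {set W}}) : isP2 M2 P ->
  splits M2 (repU P) /\ P = [set repU P; ~: repU P].
Proof.
case/existsP=> U /and3P [/eqP PE _ sU]; rewrite /repU; case: pickP => [U' | /(_ U)]; last first.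
  by rewrite PE !inE eqxx.
rewrite PE !inE => /orP [] /eqP ->; split=> //=.
  by rewrite splits_compl.
by rewrite setCK setUC.
Qed.

Lemma isP2_pair U : splits M2 U -> isP2 M2 [set U; ~: U].
Proof. by move=> sU; apply/existsP; exists U; rewrite eqxx card_split // eqxx. Qed.

(** Each pair comes from two sets, [U] and its complement, and splitting is invariant under
    complement. *)
Lemma card_P2_splits (m : {ffun W -> W}) :
  (#|[set P | isP2 M2 P && splits m (repU P)]| * 2 = #|[set U | splits M2 U && splits m U]|)%N.
Proof.
rewrite -[RHS]sum1_card (partition_big (fun U => [set U; ~: U])
  (fun P => P \in [set P | isP2 M2 P && splits m (repU P)])) /=; last first.
  move=> U; rewrite !inE => /andP [sU smU]; rewrite isP2_pair //=.
  have [_ /setP /(_ U)] := isP2P (isP2_pair sU).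
  by rewrite !inE eqxx => /esym /orP [] /eqP UE; [|rewrite -splits_compl]; rewrite -UE.
rewrite -sum_nat_const; apply: eq_bigr => P; rewrite inE => /andP [P2 smU].
have [sU PE] := isP2P P2; set U := repU P in smU sU PE *.
have UC : U != ~: U.
  apply/eqP => /setP /(_ (a (Ordinal n_gt0))); rewrite inE; by case: (_ \in U).
rewrite sum1_card -(eq_card (A := [set U; ~: U])) ?cards2 ?UC // => U'.
rewrite !inE unfold_in /= !inE; apply/orP/andP => [[] /eqP -> | [_ /eqP U'E]].
- by rewrite sU smU PE eqxx.
- by rewrite !splits_compl sU smU setCK PE setUC eqxx.
have : U \in [set U'; ~: U'] by rewrite U'E PE !inE eqxx.
by rewrite !inE => /orP [] /eqP ->; rewrite ?setCK eqxx; [left | right].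
Qed.

Variable U : {set W}.
Hypothesis sU : splits M2 U.
Local Notation u := (uvert M2 a U).
Local Notation v := (vvert M2 a U).

Lemma uvertP k : u k \in U.
Proof. by rewrite /uvert; case: ifP => // /negbT; rewrite (splitsP _ _ sU). Qed.

Lemma vvertP k : v k \notin U.
Proof. by rewrite /vvert; case: ifPn => //; rewrite (splitsP _ _ sU) => ->. Qed.

Lemma M2_uvert k : M2 (u k) = v k.
Proof. by rewrite /uvert /vvert; case: ifP. Qed.

Lemma uvert_vvert_cover w : exists k, w = u k \/ w = v k.
Proof.
have [k [H _]] := aP w; exists k; rewrite /uvert /vvert.
by case: ifP => _; case: H; auto.
Qed.

Lemma uvert_inj : injective u.
Proof.
have au k : u k = a k \/ u k = M2 (a k) by rewrite /uvert; case: ifP; auto.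
move=> k k' eqk; have [k0 [_ uniq]] := aP (u k).
by rewrite -(uniq k) // -(uniq k') // eqk.
Qed.

Lemma uvert_neq_vvert k k' : u k != v k'.
Proof. by apply: contraTneq (uvertP k) => ->; apply: vvertP. Qed.

Let cov w : exists k, (w == u k) || (w == v k).
Proof. by have [k [->|->]] := uvert_vvert_cover w; exists k; rewrite eqxx ?orbT. Qed.

Definition letter_index w := xchoose (cov w).

Let idxE w : (w == u (letter_index w)) || (w == v (letter_index w)) := xchooseP (cov w).

Lemma uvertK k : letter_index (u k) = k.
Proof. by have := idxE (u k); rewrite (negbTE (uvert_neq_vvert _ _)) orbF => /eqP /uvert_inj. Qed.

Lemma vvertK k : letter_index (v k) = k.
Proof.
have := idxE (v k); rewrite eq_sym (negbTE (uvert_neq_vvert _ _)) /= => /eqP.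
by rewrite -!M2_uvert => /(can_inj MM) /uvert_inj.
Qed.

Lemma letter_indexK w : w \in U -> u (letter_index w) = w.
Proof.
by move=> wU; have /orP [/eqP <- // | /eqP wv] := idxE w; have := vvertP (letter_index w); rewrite -wv wU.
Qed.

Lemma letter_indexKC w : w \notin U -> v (letter_index w) = w.
Proof.
by move=> wU; have /orP [/eqP wv | /eqP <- //] := idxE w; rewrite wv uvertP in wU.
Qed.

(** Each chord has one end in [U] and one smaller end; by symmetry of [Y] either may represent
    it. *)
Lemma prod_matching (A : comNzSemiRingType) (Y : W -> W -> A) (m : {ffun W -> W}) :
    (forall w w', Y w w' = Y w' w) -> is_matching m -> splits m U ->
  \prod_(w in U) Y w (m w) = \prod_(w : W | (w < m w)%N) Y w (m w).
Proof.
move=> Ysym /matchingP mP /splitsP sm; have mm w : m (m w) = w by case: (mP w).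
rewrite (bigID (fun w : W => (w < m w)%N)) [RHS](bigID (fun w => w \in U)) /=; congr (_ * _).
  by apply: eq_bigl => w; rewrite andbC.
rewrite (reindex_inj (can_inj mm)) /=; apply: eq_big => w; last by rewrite mm Ysym.
rewrite sm mm -leqNgt andbC; congr (_ && _); rewrite ltn_neqAle eq_sym.
by case: (mP w) => _ ->.
Qed.

(** Joining [u k] to [v (p k)] identifies permutations with the matchings split by [U], and
    [odd_perm_matching] gives the sign. *)
Lemma sum_perm_matching (A : comNzRingType) (Y : W -> W -> A) (Pt : {set {set W}}) :
    (forall w w', Y w w' = Y w' w) ->
  \sum_(p : 'S_n | [forall k, pblock Pt (u k) == pblock Pt (v (p k))])
     (-1) ^+ p * \prod_k Y (u k) (v (p k)) =
  \sum_(m | [&& is_matching m, [forall w, pblock Pt w == pblock Pt (m w)] & splits m U])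
     (-1) ^+ (n + ncomp M2 m) * \prod_(w : W | (w < m w)%N) Y w (m w).
Proof.
move=> Ysym.
pose mk (p : 'S_n) : {ffun W -> W} :=
  [ffun w => if w \in U then v (p (letter_index w)) else u ((p^-1)%g (letter_index w))].
have mku (p : 'S_n) k : mk p (u k) = v (p k) by rewrite ffunE uvertP uvertK.
have mkv (p : 'S_n) k : mk p (v (p k)) = u k by rewrite ffunE (negbTE (vvertP _)) vvertK permK.
have mkP (p : 'S_n) w : exists k, (w = u k) \/ (w = v (p k)).
  have [k [->|->]] := uvert_vvert_cover w; first by exists k; left.
  by exists ((p^-1)%g k); right; rewrite permKV.
rewrite (partition_big mk (fun m => [&& is_matching m,
    [forall w, pblock Pt w == pblock Pt (m w)] & splits m U])) /=; last first.
  move=> p /forallP blk; apply/and3P; split.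
  - apply/matchingP => w; have [k [->|->]] := mkP p w; rewrite ?(mku, mkv); split=> //.
      by rewrite eq_sym uvert_neq_vvert.
    exact: uvert_neq_vvert.
  - by apply/forallP => w; have [k [->|->]] := mkP p w; rewrite ?(mku, mkv) // eq_sym.
  - apply/splitsP => w; have [k [->|->]] := mkP p w; rewrite ?(mku, mkv) ?uvertP.
      by rewrite (negbTE (vvertP _)).
    by rewrite vvertP.
apply: eq_bigr => m /and3P [mm blk sm].
have mP := matchingP _ mm; have mK w : m (m w) = w by case: (mP w).
have mu k : v (letter_index (m (u k))) = m (u k).
  by apply: letter_indexKC; rewrite (splitsP _ _ sm) uvertP.
have p_inj : injective (fun k => letter_index (m (u k))).
  move=> k k' /(congr1 v); rewrite !mu => /(can_inj mK); exact: uvert_inj.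
pose p := perm p_inj; have pE k : v (p k) = m (u k) by rewrite permE mu.
have mkp : mk p = m.
  apply/ffunP => w; have [k [->|->]] := mkP p w; rewrite ?(mku, mkv) ?pE //.
rewrite (big_pred1 p) => [|p']; last first.
  apply/andP/eqP => [[_ /eqP mp'] | ->].
    by apply/permP => k; rewrite permE -mp' mku vvertK.
  split; last by rewrite mkp.
  by apply/forallP => k; rewrite pE; move/forallP: blk.
congr (_ * _).
  rewrite (odd_perm_matching MP mP uvert_inj uvert_neq_vvert uvert_vvert_cover M2_uvert (fun k => esym (pE k))).
  by rewrite -oddD signr_odd.
rewrite -prod_matching // (reindex_onto u letter_index) /=; last by move=> w; apply: letter_indexK.
by apply: eq_big => [k | k _]; rewrite ?uvertP ?uvertK ?eqxx // pE.
Qed.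

End WordMatchings.

(** * The partition polynomial *)

(** Compatibility with [M1] and with [m] together means that blocks are unions of components, the
    form to which [sum_closed_partitions_fact] applies. *)
Lemma closed_partition_isPart n (M1 : 'I_(n.*2) -> 'I_(n.*2)) (m : {ffun 'I_(n.*2) -> 'I_(n.*2)}) Pt :
    is_matching m ->
  closed_partition (chordrel M1 m) Pt =
    isPart M1 Pt && [forall w, pblock Pt w == pblock Pt (m w)].
Proof.
move=> /matchingP mP; rewrite /closed_partition /isPart -andbA.
case: (boolP (partition Pt _)) => //= pPt; have /and3P [/eqP cPt tPt _] := pPt.
have cov w : w \in cover Pt by rewrite cPt inE.
apply/forallP/andP => [H | [/forallP H1 /forallP H2] w].
  have bl w z : chordrel M1 m w z -> pblock Pt w = pblock Pt z.
    by move=> wz; have /forallP/(_ z)/implyP/(_ wz)/eqP := H w.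
  split; apply/forallP.
    move=> B; apply/implyP => BPt; apply/forallP => w; apply/implyP => wB.
    by rewrite -(def_pblock tPt BPt wB) (bl w (M1 w)) ?mem_pblock // /chordrel eqxx.
  by move=> w; rewrite -(bl w (m w)) // /chordrel eqxx orbC; case: (mP w) => _ ->.
apply/forallP => z; apply/implyP => /orP [/eqP -> | /andP [/eqP -> _]]; last exact: H2.
have /implyP/(_ (pblock_mem (cov w)))/forallP/(_ w) := H1 (pblock Pt w).
by rewrite mem_pblock cov /= => M1w; rewrite -(def_pblock tPt _ M1w) ?eqxx // pblock_mem.
Qed.

(** Each block contains a pair [w], [M1 w]. The bounds show that the range of [l] in [Z1] covers all
    partitions. *)
Lemma card_isPart n (M1 : 'I_(n.*2) -> 'I_(n.*2)) Pt : (0 < n)%N ->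
  (forall w, M1 (M1 w) = w /\ M1 w != w) -> isPart M1 Pt -> (0 < #|Pt| <= n)%N.
Proof.
move=> n_gt0 MP /andP [pPt /forallP clP]; have /and3P [/eqP cPt tPt nPt] := pPt.
have wd : (0 < n.*2)%N by rewrite double_gt0.
apply/andP; split.
  by apply/card_gt0P; exists (pblock Pt (Ordinal wd)); rewrite pblock_mem // cPt inE.
rewrite -leq_double -[X in (_ <= X)%N](card_ord n.*2) -cardsT (card_partition pPt).
rewrite -muln2 -sum_nat_const; apply: leq_sum => B BPt.
have [B0 | [w wB]] := set_0Vmem B; first by rewrite -B0 BPt in nPt.
have M1B : M1 w \in B by move: (clP B); rewrite BPt => /forallP/(_ w); rewrite wB.
have [_ ne] := MP w; rewrite -[X in (X <= _)%N](_ : #|[set w; M1 w]| = 2).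
  by apply: subset_leq_card; apply/subsetP => z /set2P [] ->.
by rewrite cards2 eq_sym ne.
Qed.

(** * From the partition polynomial to perfect matchings with a marked chord *)

Section Assembly.
Variables (R : fieldType) (V E : finType) (Gam Gbul : graph V E) (alpha : E -> R).
Variables (n : nat) (M1 M2 : 'I_(n.*2) -> 'I_(n.*2)) (a : 'I_n -> 'I_(n.*2)).
Variables (lab : 'I_(n.*2) -> E) (xi : 'I_(n.*2) -> R).
Local Notation W := 'I_(n.*2).
Local Notation K := (Kirchhoff Gam alpha).
Local Notation Kb := (Kirchhoff Gbul alpha).
Local Notation X w w' := (cyclepoly Gam alpha (lab w) (lab w')).
Hypothesis char0 : [pchar R] =i pred0.
Hypothesis n_gt0 : (0 < n)%N.
Hypotheses (K0 : K != 0) (Kb0 : Kb != 0).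
Hypotheses (M1P : forall w, M1 (M1 w) = w /\ M1 w != w) (M2P : forall w, M2 (M2 w) = w /\ M2 w != w).
Hypothesis aP : forall w, exists! k, w = a k \/ w = M2 (a k).
Hypothesis XbE : forall w w', cyclepoly Gbul alpha (lab w) (lab w') =
  Kb / K * X w w' + K^-1 * (xi w * xi w').

Let w0 : W.
Proof. by apply: (@Ordinal _ 0); rewrite double_gt0. Qed.

Let Y := edge_weight Gam alpha lab xi.

Let Ysym w w' : Y w w' = Y w' w.
Proof. by rewrite /Y /edge_weight cyclepoly_sym (mulrC (xi w)). Qed.

Definition matching_coef (m : {ffun W -> W}) : R := (\prod_(w : W | (w < m w)%N) Y w (m w))`_1.

Lemma uword_word U B : uword M2 a lab U B = map lab (word (uvert M2 a U) B).
Proof. by rewrite /uword /word -map_comp. Qed.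

Lemma vword_word U B : vword M2 a lab U B = map lab (word (vvert M2 a U) B).
Proof. by rewrite /vword /word -map_comp. Qed.

(** The bracket is the first coefficient of one block determinant and the other factors are constant
    coefficients, so the sum over [B] is the product rule; each of the [#|Pt|.-1] unmarked blocks
    gives a factor [K]. *)
Lemma partition_summand Pt U : partition Pt [set: W] -> splits M2 U ->
  sgnE M2 a R Pt U *
   (\sum_(B in Pt)
     (dodgson Gbul alpha (uword M2 a lab U B) (vword M2 a lab U B)
      - Kb / K * dodgson Gam alpha (uword M2 a lab U B) (vword M2 a lab U B))
     * \prod_(B' in Pt | B' != B) dodgson Gam alpha (uword M2 a lab U B') (vword M2 a lab U B'))
  = K ^+ #|Pt|.-1 *
    \sum_(m | [&& is_matching m, [forall w, pblock Pt w == pblock Pt (m w)] & splits m U])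
      (-1) ^+ (n + ncomp M2 m) * matching_coef m.
Proof.
move=> pPt sU; set u := uvert M2 a U; set v := vvert M2 a U.
have /and3P [/eqP cPt tPt nPt] := pPt.
have -> : \sum_(m | [&& is_matching m, [forall w, pblock Pt w == pblock Pt (m w)] & splits m U])
      (-1) ^+ (n + ncomp M2 m) * matching_coef m =
    (\sum_(p : 'S_n | [forall k, pblock Pt (u k) == pblock Pt (v (p k))])
     (-1) ^+ p * \prod_k Y (u k) (v (p k)))`_1.
  rewrite (sum_perm_matching M2P aP sU Pt Ysym) coef_sum; apply: eq_bigr => m _.
  by rewrite -(rmorph_sign (@polyC R)) coefCM.
rewrite /sgnE; case: ifP => [/forallP bal | /forallP unbal]; last first.
  (* A permutation respecting the blocks would match the letters of the two words block by block, so
     in the unbalanced case there is none. *)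
  rewrite mul0r big_pred0 ?coef0 ?mulr0 // => p; apply/negP => /forallP blk; case: unbal => B.
  apply/implyP => BPt; apply/eqP.
  have inB w : (w \in B) = (pblock Pt w == B).
    apply/idP/eqP => [|<-]; first exact: def_pblock.
    by rewrite mem_pblock cPt inE.
  rewrite -(card_imset _ (@perm_inj _ p)); apply: eq_card => k.
  rewrite -{1}[k](permKV p) (mem_imset _ _ (@perm_inj _ p)) !inE.
  by rewrite !inB (eqP (blk _)) permKV.
have {}bal B : B \in Pt -> size (word u B) = size (word v B).
  by move=> BPt; rewrite !size_word; apply/eqP; have /implyP := bal B; apply.
have pos B : B \in Pt -> (0 < size (word u B))%N.
  move=> BPt; have [B0 | [w wB]] := set_0Vmem B; first by rewrite -B0 BPt in nPt.
  have [k [wk | wk]] : exists k, w = u k \/ w = v k := uvert_vvert_cover aP U w; [|rewrite bal //]; rewrite size_word;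
    by apply/card_gt0P; exists k; rewrite inE -wk.
rewrite -(block_det Y w0 pPt bal) !(psignE _ pPt) -(rmorph_sign (@polyC R) (newperm u pPt)).
rewrite -(rmorph_sign (@polyC R) (newperm v pPt)) -polyCM coefCM mulrCA; congr (_ * _).
rewrite coef1_prod mulr_sumr; apply: eq_bigr => B BPt.
rewrite uword_word vword_word (dodgson_coef1 w0 K0 Kb0 XbE (pos _ BPt) (bal _ BPt)).
rewrite [RHS]mulrCA; congr (_ * _).
rewrite (eq_bigr (fun B' => K * (det_words Y u v w0 B')`_0)); last first.
  by move=> B' /andP [B'Pt _]; rewrite uword_word vword_word (dodgson_coef0 w0 lab xi K0 (pos _ B'Pt) (bal _ B'Pt)).
rewrite big_split /=; congr (_ * _).
rewrite (eq_bigl [in Pt :\ B]); last by move=> B'; rewrite in_setD1 andbC.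
by rewrite prodr_const (cardsD1 B Pt) BPt.
Qed.

(** After exchanging sums, a matching is counted once for each pair it is compatible with: half of
    the [2 ^ ncomp M2 m] sets that it splits along with [M2]. *)
Lemma sum_P2 Pt :
  \sum_(P | isP2 M2 P)
    \sum_(m | [&& is_matching m, [forall w, pblock Pt w == pblock Pt (m w)] & splits m (repU P)])
      (-1) ^+ (n + ncomp M2 m) * matching_coef m
  = \sum_(m | is_matching m && [forall w, pblock Pt w == pblock Pt (m w)])
      (2 ^ (ncomp M2 m).-1)%:R * ((-1) ^+ (n + ncomp M2 m) * matching_coef m).
Proof.
rewrite (exchange_big_dep (fun m : {ffun W -> W} => is_matching m &&
   [forall w, pblock Pt w == pblock Pt (m w)])) /=; last first.
  by move=> P m _ /and3P [-> ->].
apply: eq_bigr => m /andP [mm blk]; rewrite mm blk /= sumr_const mulr_natl; congr (_ *+ _).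
have mP := matchingP _ mm.
apply/eqP; rewrite -(eqn_pmul2r (m := 2)) // -expnSr prednK; last first.
  by rewrite (ncomp_cut M2P mP w0).
rewrite -(card_splits M2P mP) -(card_P2_splits a n_gt0 M2P); apply/eqP; congr (_ * _)%N.
by apply: eq_card => P; rewrite !inE.
Qed.

Lemma sum_over_cardinal (F : nat -> {set {set W}} -> R) :
  \sum_(1 <= l < n.+1) \sum_(Pt | isPart M1 Pt && (#|Pt| == l)) F l Pt
  = \sum_(Pt | isPart M1 Pt) F #|Pt| Pt.
Proof.
rewrite (exchange_big_dep (isPart M1)) /=; last by move=> l Pt _ /andP [].
apply: eq_bigr => Pt PtP; rewrite PtP /= -big_filter (eq_filter (a2 := pred1 #|Pt|)).
  by rewrite filter_pred1_uniq ?iota_uniq ?big_seq1 // mem_index_iota ltnS (card_isPart n_gt0 M1P).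
by move=> l; rewrite /= eq_sym.
Qed.

(** The product rule marks one of the [n] chords; each chord contributes one factor [K^-1]. *)
Lemma matching_coefE m : is_matching m -> matching_coef m =
  K ^- n * \sum_(w : W | (w < m w)%N) xi w * xi (m w) *
             \prod_(z : W | (z < m z)%N && (z != w)) X z (m z).
Proof.
move=> mm; have mP := matchingP _ mm.
pose S := [set w : W | (w < m w)%N].
have cS : #|S| = n.
  apply: (card_split mP); apply/splitsP => w; rewrite !inE; have [-> ne] := mP w.
  by rewrite -leqNgt [RHS]leq_eqVlt; move: ne; rewrite -val_eqE /= => /negbTE ->.
have inS w : (w \in S) = (w < m w)%N by rewrite inE.
rewrite /matching_coef -(eq_bigl _ _ inS) coef1_prod mulr_sumr (eq_bigl _ _ inS).
apply: eq_bigr => w wS.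
have Y0 z z' : (Y z z')`_0 = X z z' / K.
  by rewrite /Y /edge_weight coefD coefC coefXM addr0.
have Y1 z z' : (Y z z')`_1 = xi z * xi z' / K.
  by rewrite /Y /edge_weight coefD coefC coefXM coefC add0r.
rewrite Y1 (eq_bigr (fun z => X z (m z) / K)) => [|z _]; last exact: Y0.
rewrite big_split /= (eq_bigl (fun z : W => (z < m z)%N && (z != w))); last by move=> z; rewrite inS.
have -> : \prod_(z in S | z != w) K^-1 = K ^- n.-1.
  rewrite (eq_bigl [in S :\ w]); last by move=> z; rewrite in_setD1 andbC.
  have cSw : #|S :\ w| = n.-1 by rewrite -[k in _ = k.-1]cS (cardsD1 w S) inS wS.
  by rewrite prodr_const exprVn cSw.
have -> : K ^- n = (K * K ^+ n.-1)^-1 by rewrite -exprS prednK.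
by rewrite invfM; ring.
Qed.

(** The powers of [K] add up to [K ^+ n] for every partition and cancel those of [matching_coefE].
    The sum over partitions gives [(-2) ^+ ncomp M1 m], and the remaining signs combine with the
    number of pairs into [(-2) ^+ (ncomp M2 m).-1]. *)
Lemma Z1_matchings : Z1 Gam Gbul alpha M1 M2 a lab =
  2^-1 * \sum_(m | is_matching m) (-2) ^+ ncomp M1 m * (-2) ^+ (ncomp M2 m).-1 *
    \sum_(w : W | (w < m w)%N) xi w * xi (m w) *
             \prod_(z : W | (z < m z)%N && (z != w)) X z (m z).
Proof.
rewrite /Z1; congr (_ * _).
pose T Pt : R := \sum_(m | is_matching m && [forall w, pblock Pt w == pblock Pt (m w)])
      (2 ^ (ncomp M2 m).-1)%:R * ((-1) ^+ (n + ncomp M2 m) * matching_coef m).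
have Z1lE l : Z1l Gam Gbul alpha M1 M2 a lab l =
    \sum_(Pt | isPart M1 Pt && (#|Pt| == l)) K ^+ #|Pt|.-1 * T Pt.
  apply: eq_bigr => Pt /andP [/andP [pPt _] _]; rewrite /T -sum_P2 mulr_sumr.
  by apply: eq_bigr => P /isP2P [sU _]; apply: partition_summand.
under eq_bigr do rewrite Z1lE mulr_sumr.
rewrite sum_over_cardinal.
transitivity (\sum_(Pt | isPart M1 Pt) K ^+ n * (-1) ^+ n.+1 *
    ((-1) ^+ #|Pt| * ((#|Pt|.+1)`!)%:R * T Pt)).
  apply: eq_bigr => Pt PtP; have /andP [c0 cn] := card_isPart n_gt0 M1P PtP.
  have -> : K ^+ n = K ^+ (n - #|Pt| + 1) * K ^+ #|Pt|.-1.
    by rewrite -exprD -addnA add1n prednK // subnK.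
  rewrite (exprNn K); have -> : (-1) ^+ (n - #|Pt| + 1) = (-1) ^+ n.+1 * (-1) ^+ #|Pt| :> R.
    rewrite -exprD -[LHS]signr_odd -[RHS]signr_odd !oddD oddB //=.
    by case: (odd n); case: (odd _).
  have rearrange (p q s1 s2 f t : R) :
      s1 * s2 * p * f * (q * t) = p * q * s1 * (s2 * f * t) by ring.
  by rewrite [in LHS](addn1 #|Pt|) rearrange.
rewrite -mulr_sumr.
under eq_bigr do rewrite /T mulr_sumr.
rewrite (exchange_big_dep (@is_matching n)) /=; last by move=> Pt m _ /andP [].
rewrite mulr_sumr; apply: eq_bigr => m mm; have mP := matchingP _ mm.
rewrite (eq_bigl (closed_partition (chordrel M1 m))); last first.
  by move=> Pt; rewrite closed_partition_isPart // mm.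
rewrite -mulr_suml sum_closed_partitions_fact //; last first.
  by apply: chordrel_connect => w; [case: (M1P w) | case: (mP w)].
rewrite matching_coefE // -/(ncomp M1 m).
have := ncomp_cut M2P mP w0; set c := ncomp M2 m => cE.
set S := \sum_(w : W | _) _; set p := (-2) ^+ _.
rewrite cE /= addnS natrX; set d := c2 M2 _.
have -> : (-2) ^+ d = (-1) ^+ d * 2 ^+ d :> R by rewrite exprNn.
have s2 : (-1) ^+ n.+1 * (-1) ^+ (n + d).+1 = (-1) ^+ d :> R.
  by rewrite -exprD -[LHS]signr_odd -[RHS]signr_odd !oddD /= oddD; case: (odd n); case: (odd d).
have Kn : K ^+ n != 0 by rewrite expf_neq0.
rewrite -s2; move: (K ^+ n) Kn => Q Q0; field; exact: Q0.
Qed.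

End Assembly.

(** * The expansion over chord diagrams *)

Theorem mainTheorem7
  (R : fieldType) (char0 : [pchar R] =i pred0)
  (V E : finType) (src tgt : E -> V) (x y : V) (n : nat)
  (alpha : E -> R)
  (M1 M2 : 'I_(n.*2) -> 'I_(n.*2)) (lab : 'I_(n.*2) -> E) (a : 'I_n -> 'I_(n.*2)) :
  let Gam := Graph [set: V] [set: E] src tgt in
  let Gbul := identify Gam x y in
  (forall u v : V, connect (adj Gam [set: E]) u v) ->
  (#|E| + 1 = #|V| + n)%N ->
  (0 < n)%N ->
  x != y ->
  (forall e, alpha e != 0) ->
  Kirchhoff Gam alpha != 0 ->
  Kirchhoff Gbul alpha != 0 ->
  (forall w, M1 (M1 w) = w /\ M1 w != w) ->
  (forall w, M2 (M2 w) = w /\ M2 w != w) ->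
  injective lab ->
  (forall w, exists! k, w = a k \/ w = M2 (a k)) ->
  Z1 Gam Gbul alpha M1 M2 a lab = Z1chords Gam alpha M1 M2 lab x y.
Proof.
move=> Gam Gbul _ _ n_gt0 xy a0 K0 Kb0 M1P M2P _ aP.
have XbE w w' := cyclepoly_identify char0 xy a0 K0 Kb0 (lab w) (lab w').
rewrite (Z1_matchings char0 n_gt0 K0 Kb0 M1P M2P aP XbE) /Z1chords sum_isD1; congr (_ * _).
apply: eq_bigr => m mm; have mP := matchingP _ mm; have mK w : m (m w) = w by case: (mP w).
rewrite mulr_sumr; apply: eq_bigr => w0 lt0.
(* The opened component adds 1 for [M1], which is the extra 1 in the exponent; for [M2] it is
   absorbed by the predecessor. *)
rewrite (ncomp_cut M1P mP w0) (ncomp_cut M2P mP w0) /= -exprD addSn addn1 -[RHS]mulrA; congr (_ * _).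
rewrite [RHS]mulrC; congr (_ * _).
  have m0 : m w0 != w0 by case: (mP w0).
  rewrite (eq_bigl _ _ (cut_fix mP w0)) (bigD1 w0) ?eqxx //= (bigD1 (m w0)) ?m0 ?eqxx ?orbT //=.
  rewrite big_pred0 ?mulr1 // => w.
  by case: eqP => //= _; case: eqP.
apply: eq_big => [w | w /andP [ltw ne]]; rewrite cutE.
  have [-> | ne] := eqVneq w w0; first by rewrite ltnn andbF.
  have [-> | ne2] := eqVneq w (m w0); last by rewrite /= andbT.
  by rewrite mK ltnn andbT ltnNge ltnW.
rewrite (negbTE ne) /=; case: eqP => // wm; move: ltw; rewrite wm mK ltnNge ltnW //.
Qed.
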